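(* Let $H_1,H_2,H_3,H_4$ be Hilbert spaces over the same field ($\mathbb{R}$ or $\mathbb{C}$), and let $T_i\in\mathrm{Fr}(H_i,H_{i+1})$ be Fredholm operators, $i=1,2,3$. Then \[ \phi_{T_1,T_3T_2}\circ(\mathrm{id}\otimes\phi_{T_2,T_3})=\phi_{T_2T_1,T_3}\circ(\phi_{T_1,T_2}\otimes\mathrm{id}) \] as maps $\mathrm{Det}(T_1)\otimes\mathrm{Det}(T_2)\otimes\mathrm{Det}(T_3)\to\mathrm{Det}(T_3T_2T_1)$.
   Context: $\mathrm{Fr}(H,H')$ is the set of bounded Fredholm operators from $H$ to $H'$. For finite dimensional $X$, $\mathrm{Det}(X)=\Lambda_{\max}(X)$ is the top exterior power; for a generator $\xi$ of a line, $\xi^*$ is the dual generator. $\mathrm{Det}(T):=\mathrm{Det}(\ker T)\otimes\mathrm{Det}(\mathrm{coker}\,T)^*$ for $T$ Fredholm. For Fredholm operators $S\in\mathrm{Fr}(H,H')$, $T\in\mathrm{Fr}(H',H'')$ the isomorphism $\phi_{S,T}:\mathrm{Det}(S)\otimes\mathrm{Det}(T)\to\mathrm{Det}(TS)$ is defined by \[ \alpha_1\otimes(\pi_*\alpha_3\wedge\alpha_4)^*\otimes(\alpha_3\wedge S_*\alpha_2)\otimes\alpha_5^*\mapsto(-1)^{\rho(S,T)}(\alpha_1\wedge\alpha_2)\otimes(\alpha_5\wedge T_*\alpha_4)^*, \] with $\rho(S,T)=(\dim\ker S+\dim\ker TS)(\dim\mathrm{coker}\,T+\dim\mathrm{coker}\,TS)$,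 where one uses the exact sequence $0\to\ker S\to\ker TS\xrightarrow{S}\ker T\xrightarrow{\pi}\mathrm{coker}\,S\xrightarrow{T}\mathrm{coker}\,TS\to\mathrm{coker}\,T\to0$ ($\pi$ being the restriction of the quotient projection); $\alpha_1$ generates $\mathrm{Det}(\ker S)$, $\alpha_1\wedge\alpha_2$ generates $\mathrm{Det}(\ker TS)$, $\alpha_3\wedge S_*\alpha_2$ generates $\mathrm{Det}(\ker T)$, $\pi_*\alpha_3\wedge\alpha_4$ generates $\mathrm{Det}(\mathrm{coker}\,S)$, $\alpha_5\wedge T_*\alpha_4$ generates $\mathrm{Det}(\mathrm{coker}\,TS)$, and (the image of) $\alpha_5$ generates $\mathrm{Det}(\mathrm{coker}\,T)$. The $\alpha_i$ are homogeneous elements of the relevant exterior algebras; $\phi_{S,T}$ does not depend on their choice. *)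

(* Defs.v *)
From HB Require Import structures.
From mathcomp Require Import all_boot all_order all_algebra.
From mathcomp Require Import generic_quotient ring_quotient.
From mathcomp Require Import freeg complex.
From mathcomp Require Import boolp classical_sets functions reals.
From mathcomp Require Import topology tvs pseudometric_normed_Zmodule normed_module complete_normed_module.

Set Implicit Arguments.
Unset Strict Implicit.
Unset Printing Implicit Defensive.

Import GRing.Theory Num.Theory.

Local Open Scope classical_set_scope.
Local Open Scope ring_scope.
Local Open Scope quotient_scope.

Section Span.
Context {K : fieldType} {V : lmodType K}.

Inductive in_span (A : set V) : V -> Prop :=
| in_span0 : in_span A 0
| in_spanD a v w of A v & in_span A w : in_span A (a *: v + w).

Definition span (A : set V) : {pred V} := fun x => `[< in_span A x >].

Lemma spanP (A : set V) x : reflect (in_span A x) (x \in span A).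
Proof. exact: asboolP. Qed.

Lemma span_submod_closed (A : set V) : submod_closed (span A).
Proof.
split; first exact/spanP/in_span0.
move=> a x y /spanP sx /spanP sy; apply/spanP; elim: sx => [|b v w Av _ IH].
  by rewrite scaler0 add0r.
by rewrite scalerDr scalerA -addrA; apply: in_spanD.
Qed.

HB.instance Definition _ (A : set V) :=
  GRing.isSubmodClosed.Build K V (span A) (span_submod_closed A).

Lemma mem_span (A : set V) x : A x -> x \in span A.
Proof.
by move=> Ax; apply/spanP; rewrite -[x]scale1r -[_ *: x]addr0; apply: in_spanD (in_span0 A).
Qed.

Lemma span_id (A : set V) :
    A 0 -> (forall a x y, A x -> A y -> A (a *: x + y)) ->
  forall x, x \in span A <-> A x.
Proof.
move=> A0 AD x; split; last exact: mem_span.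
by move/spanP; elim=> // a v w Av _ Aw; apply: AD.
Qed.

(* Subspaces and quotients are presented by an arbitrary spanning set; whenever
   they are used below for a set which already is a subspace (kernel, range,
   linear forms), [span_id] applies. *)
Definition subsp (A : set V) : Type := {x : V | x \in span A}.

Definition quotsp (A : set V) : Type := {ideal_quot (span A)}.

End Span.

HB.instance Definition _ (K : fieldType) (V : lmodType K) (A : set V) :=
  SubChoice.on (subsp A).
HB.instance Definition _ (K : fieldType) (V : lmodType K) (A : set V) :=
  [SubChoice_isSubLmodule of subsp A by <:].
HB.instance Definition _ (K : fieldType) (V : lmodType K) (A : set V) :=
  ZmodQuotient.on (quotsp A).

Section QuotientSpace.
Context {K : fieldType} {V : lmodType K} (A : set V).

Definition qproj (x : V) : quotsp A := \pi_(quotsp A) x.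

Lemma qproj_eq x y : qproj x = qproj y <-> x - y \in span A.
Proof.
rewrite /qproj; split; first by move/eqP; rewrite piE /= Quotient.equivE.
by move=> h; apply/eqP; rewrite piE /= Quotient.equivE.
Qed.

Lemma qproj_repr (q : quotsp A) : qproj (repr q) = q.
Proof. exact: reprK. Qed.

Lemma qproj_surj (q : quotsp A) : exists x, qproj x = q.
Proof. by exists (repr q); rewrite qproj_repr. Qed.

Lemma qprojD x y : qproj (x + y) = qproj x + qproj y.
Proof. by rewrite /qproj piE. Qed.

Definition qscale (a : K) (q : quotsp A) : quotsp A := qproj (a *: repr q).

Lemma qproj_scale a x : qproj (a *: x) = qscale a (qproj x).
Proof.
by apply/qproj_eq; rewrite -scalerBr rpredZ //; apply/qproj_eq; rewrite qproj_repr.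
Qed.

Fact qscaleA a b q : qscale a (qscale b q) = qscale (a * b) q.
Proof.
by case: (qproj_surj q) => x <-; rewrite -!qproj_scale scalerA.
Qed.

Fact qscale1 : left_id 1 qscale.
Proof. by move=> q; case: (qproj_surj q) => x <-; rewrite -qproj_scale scale1r. Qed.

Fact qscaleDr : right_distributive qscale +%R.
Proof.
move=> a p q; case: (qproj_surj p) (qproj_surj q) => x <- [y <-].
by rewrite -qprojD -!qproj_scale -qprojD scalerDr.
Qed.

Fact qscaleDl q : {morph qscale^~ q : a b / a + b}.
Proof.
move=> a b; case: (qproj_surj q) => x <-.
by rewrite -!qproj_scale -qprojD scalerDl.
Qed.

HB.instance Definition _ :=
  GRing.Zmodule_isLmodule.Build K (quotsp A) qscaleA qscale1 qscaleDr qscaleDl.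

Fact qproj_linear : linear qproj.
Proof. by move=> a x y; rewrite qprojD qproj_scale. Qed.

HB.instance Definition _ := GRing.isLinear.Build K V (quotsp A) _ qproj qproj_linear.

Context {W : lmodType K} (f : {linear V -> W}) (f0 : forall x, A x -> f x = 0).

Lemma span_lin0 x : x \in span A -> f x = 0.
Proof.
move/spanP; elim=> [|a v w Av _ IH]; first exact: linear0.
by rewrite linearP f0 // IH scaler0 addr0.
Qed.

(* The factorization of f through V / span A. *)
Definition qlift of (forall x, A x -> f x = 0) : quotsp A -> W :=
  fun q => f (repr q).

Lemma qliftE x : qlift f0 (qproj x) = f x.
Proof.
by apply/eqP; rewrite -subr_eq0 -linearB span_lin0 //; apply/qproj_eq/qproj_repr.
Qed.

Fact qlift_linear : linear (qlift f0).
Proof.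
move=> a p q; case: (qproj_surj p) (qproj_surj q) => x <- [y <-].
by rewrite -linearP !qliftE linearP.
Qed.

HB.instance Definition _ :=
  GRing.isLinear.Build K (quotsp A) W _ (qlift f0) qlift_linear.

End QuotientSpace.

Section InducedMaps.
Context {K : fieldType} {U V : lmodType K} (A : set U) (B : set V).
Context (f : {linear U -> V}) (fAB : forall x, A x -> B (f x)).

Fact span_map x : x \in span A -> f x \in span B.
Proof.
move/spanP; elim=> [|a v w Av _ IH]; first by rewrite linear0 rpred0.
by rewrite linearP; apply: rpredD => //; apply/rpredZ/mem_span/fAB.
Qed.

Definition restr : subsp A -> subsp B :=
  fun x => Sub (f (val x)) (span_map (valP x)).

Fact restr_linear : linear restr.
Proof. by move=> a x y; apply: val_inj; rewrite /= !linearP. Qed.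

HB.instance Definition _ :=
  GRing.isLinear.Build K (subsp A) (subsp B) _ restr restr_linear.

Fact qmap_subproof x : A x -> (qproj B \o f) x = 0.
Proof.
move=> Ax; rewrite /= -(linear0 (qproj B)); apply/qproj_eq.
by rewrite subr0; apply/mem_span/fAB.
Qed.

Definition qmap : quotsp A -> quotsp B :=
  qlift qmap_subproof.

HB.instance Definition _ := GRing.Linear.on qmap.

End InducedMaps.

Section FreeModule.
Context {K : fieldType} {X : choiceType}.

Definition fgen (x : X) : {freeg X / K} := [freeg [:: (1, x)]].

Lemma fgenZ a x : a *: fgen x = [freeg [:: (a, x)]].
Proof.
by apply/eqP/freeg_eqP => y; rewrite coeffZ !coeffU mul1r.
Qed.

Lemma freeg_gen (z : {freeg X / K}) : z = \sum_(x <- dom z) coeff x z *: fgen x.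
Proof. by rewrite -[LHS]freeg_sumE; apply: eq_bigr => x _; rewrite fgenZ. Qed.

Context {W : lmodType K} (f : X -> W).

Definition flift : {freeg X / K} -> W := fglift f.

Lemma fliftE x : flift (fgen x) = f x.
Proof. by rewrite /flift liftU scale1r. Qed.

Fact flift_linear : linear flift.
Proof.
have addf u v : flift (u - v) = flift u - flift v by exact: lift_is_additive.
have f0 : flift 0 = 0 by rewrite -[0 in LHS](subrr 0) addf subrr.
have fN u : flift (- u) = - flift u by rewrite -[- u]sub0r addf f0 sub0r.
have fD u v : flift (u + v) = flift u + flift v.
  by rewrite -[v in LHS]opprK addf fN opprK.
have fsum (r : seq X) F : flift (\sum_(x <- r) F x) = \sum_(x <- r) flift (F x).
  by elim: r => [|x r IH]; rewrite ?big_nil // !big_cons fD IH.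
move=> a u v; rewrite fD; congr (_ + _).
rewrite [u]freeg_gen scaler_sumr !fsum scaler_sumr; apply: eq_bigr => x _.
by rewrite scalerA !fgenZ /flift !liftU scalerA.
Qed.

HB.instance Definition _ :=
  GRing.isLinear.Build K {freeg X / K} W _ flift flift_linear.

End FreeModule.

Section ExteriorAlgebra.
Context {K : fieldType}.
Implicit Types U V W : lmodType K.

(* The span of [ext_rel V] in the free vector space on the words over V -
   concatenation of words being the tensor product - is the sum of the relations
   defining the tensor algebra of V and of the two-sided ideal generated by the
   squares x (x) x. *)
Inductive ext_rel V : set {freeg (seq V) / K} :=
| ext_rel_linear s t a x y :
    ext_rel (fgen (s ++ (a *: x + y) :: t) -
             (a *: fgen (s ++ x :: t) + fgen (s ++ y :: t)))
| ext_rel_alt s t x : ext_rel (fgen (s ++ x :: x :: t)).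

Definition ext V : Type := quotsp (ext_rel (V := V)).
HB.instance Definition _ V := GRing.Lmodule.on (ext V).

(* [word [:: x1; ...; xk]] is x1 /\ ... /\ xk. *)
Definition word V (s : seq V) : ext V := qproj (ext_rel (V := V)) (fgen s).

Lemma word_linear V (s t : seq V) a x y :
  word (s ++ (a *: x + y) :: t) = a *: word (s ++ x :: t) + word (s ++ y :: t).
Proof.
rewrite /word -linearP; apply/qproj_eq/mem_span; exact: ext_rel_linear.
Qed.

Lemma word_alt V (s t : seq V) x : word (s ++ x :: x :: t) = 0.
Proof.
rewrite -(linear0 (qproj (ext_rel (V := V)))) /word; apply/qproj_eq.
by rewrite subr0; apply/mem_span/ext_rel_alt.
Qed.

Section Lift.
Context {V W : lmodType K} (f : seq V -> W).

Definition alternating_word_map :=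
  (forall s t a x y,
     f (s ++ (a *: x + y) :: t) = a *: f (s ++ x :: t) + f (s ++ y :: t)) /\
  (forall s t x, f (s ++ x :: x :: t) = 0).

Hypothesis fP : alternating_word_map.

Fact ext_lift_subproof z : ext_rel z -> flift f z = 0.
Proof.
case: fP => flin falt [s t a x y|s t x]; last by rewrite fliftE falt.
by rewrite linearB linearP /= !fliftE flin subrr.
Qed.

Definition ext_lift : ext V -> W :=
  qlift ext_lift_subproof.

HB.instance Definition _ := GRing.Linear.on ext_lift.

Lemma ext_liftE s : ext_lift (word s) = f s.
Proof. by rewrite [LHS]qliftE /= fliftE. Qed.

End Lift.

Section Functoriality.
Context {V W : lmodType K} (f : {linear V -> W}).

Fact ext_map_subproof : alternating_word_map (fun s => word (map f s)).
Proof.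
split=> [s t a x y|s t x]; rewrite !map_cat /=; last exact: word_alt.
by rewrite linearP word_linear.
Qed.

Definition ext_map : ext V -> ext W := ext_lift ext_map_subproof.
HB.instance Definition _ := GRing.Linear.on ext_map.

Lemma ext_map_word s : ext_map (word s) = word (map f s).
Proof. exact: ext_liftE. Qed.

End Functoriality.

Section Wedge.
Context {V : lmodType K}.

Fact wedge_subproof1 (s : seq V) :
  alternating_word_map (fun t => word (s ++ t)).
Proof.
split=> [t u a x y|t u x]; rewrite !catA; [exact: word_linear|exact: word_alt].
Qed.

Definition wordl (s : seq V) : ext V -> ext V := ext_lift (wedge_subproof1 s).
HB.instance Definition _ s := GRing.Linear.on (wordl s).

Lemma wordlE s t : wordl s (word t) = word (s ++ t).
Proof. exact: ext_liftE. Qed.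

Lemma ext_ind (P : ext V -> Prop) :
  (forall s, P (word s)) -> (forall a x y, P x -> P y -> P (a *: x + y)) ->
  forall x, P x.
Proof.
move=> Pw PD x; case: (qproj_surj x) => z <-.
have P0 : P 0.
  by rewrite -[0](subrr (word [::])) addrC -scaleN1r; apply: PD; apply: Pw.
rewrite [z]freeg_gen linear_sum; elim: (dom z) => [|s r IH].
  by rewrite big_nil.
by rewrite big_cons linearZ; apply: PD => //; apply: Pw.
Qed.

Fact wedge_subproof2 : alternating_word_map (wordl : _ -> (ext V -> ext V)).
Proof.
split=> [s t a x y|s t x]; apply/funext => z.
  rewrite -[RHS]/(a *: wordl (s ++ x :: t) z + wordl (s ++ y :: t) z).
  elim/ext_ind: z => [u|b z w IHz IHw].
    by rewrite !wordlE -!catA !cat_cons word_linear.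
  rewrite !linearP /= IHz IHw !scalerDr !scalerA [b * a]mulrC.
  by rewrite -!addrA; congr (_ + _); rewrite addrCA.
rewrite -[RHS]/0; elim/ext_ind: z => [u|b z w IHz IHw].
  by rewrite wordlE -catA !cat_cons word_alt.
by rewrite linearP /= IHz IHw scaler0 addr0.
Qed.

Definition wedge (x : ext V) : ext V -> ext V := ext_lift wedge_subproof2 x.

Lemma wedge_word s t : wedge (word s) (word t) = word (s ++ t).
Proof. by rewrite /wedge ext_liftE wordlE. Qed.

Lemma wedge_linearl y : linear (wedge^~ y).
Proof. by move=> a x x'; rewrite /wedge linearP. Qed.

Lemma wedge_linearr x : linear (wedge x).
Proof.
elim/ext_ind: x => [s|b x x' IH IH'] a y z; first by rewrite /wedge ext_liftE linearP.
rewrite !(wedge_linearl _ b x x') IH IH' !scalerDr !scalerA [b * a]mulrC.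
by rewrite -!addrA; congr (_ + _); rewrite addrCA.
Qed.

End Wedge.

(* [span (extpow k)] is the k-th exterior power, inside the exterior algebra. *)
Definition extpow V (k : nat) : set (ext V) := [set word s | s in [set s | size s = k]].

Definition homogeneous V (x : ext V) := exists k, x \in span (extpow (V := V) k).

End ExteriorAlgebra.

Section TensorProduct.
Context {K : fieldType}.
Implicit Types U V W : lmodType K.

Inductive tens_rel U V : set {freeg (U * V)%type / K} :=
| tens_rel_l a u u' v :
    tens_rel (fgen (a *: u + u', v) - (a *: fgen (u, v) + fgen (u', v)))
| tens_rel_r a u v v' :
    tens_rel (fgen (u, a *: v + v') - (a *: fgen (u, v) + fgen (u, v'))).

Definition tens U V : Type := quotsp (tens_rel (U := U) (V := V)).
HB.instance Definition _ U V := GRing.Lmodule.on (tens U V).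

Definition tensor U V (u : U) (v : V) : tens U V :=
  qproj (tens_rel (U := U) (V := V)) (fgen (u, v)).

Lemma tensor_linearl U V (v : V) : linear (fun u : U => tensor u v).
Proof.
by move=> a u u'; rewrite /tensor -linearP; apply/qproj_eq/mem_span/tens_rel_l.
Qed.

Lemma tensor_linearr U V (u : U) : linear (fun v : V => tensor u v).
Proof.
by move=> a v v'; rewrite /tensor -linearP; apply/qproj_eq/mem_span/tens_rel_r.
Qed.

Lemma tens_ind U V (P : tens U V -> Prop) :
    (forall u v, P (tensor u v)) ->
    (forall a x y, P x -> P y -> P (a *: x + y)) ->
  forall x, P x.
Proof.
move=> Pw PD x; case: (qproj_surj x) => z <-.
have P0 : P 0.
  by rewrite -[0](subrr (tensor 0 0)) addrC -scaleN1r; apply: PD; apply: Pw.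
rewrite [z]freeg_gen linear_sum; elim: (dom z) => [|[u v] r IH].
  by rewrite big_nil.
by rewrite big_cons linearZ; apply: PD => //; apply: Pw.
Qed.

Section Lift.
Context {U V W : lmodType K} (b : U -> V -> W).

Definition bilinear_map :=
  (forall v, linear (b^~ v)) /\ (forall u, linear (b u)).

Hypothesis bP : bilinear_map.

Fact tens_lift_subproof z : tens_rel z -> flift (fun p => b p.1 p.2) z = 0.
Proof.
case: bP => bl br [a u u' v|a u v v']; rewrite linearB linearP /= !fliftE /=.
  by rewrite (bl v) subrr.
by rewrite (br u) subrr.
Qed.

Definition tens_lift : tens U V -> W := qlift tens_lift_subproof.
HB.instance Definition _ := GRing.Linear.on tens_lift.

Lemma tens_liftE u v : tens_lift (tensor u v) = b u v.
Proof. by rewrite [LHS]qliftE /= fliftE. Qed.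

End Lift.

Section Map.
Context {U V U' V' : lmodType K} (f : {linear U -> U'}) (g : {linear V -> V'}).

Fact tens_map_subproof : bilinear_map (fun u v => tensor (f u) (g v)).
Proof.
by split=> [v|u] a x y; rewrite linearP ?tensor_linearl ?tensor_linearr.
Qed.

Definition tens_map : tens U V -> tens U' V' := tens_lift tens_map_subproof.
HB.instance Definition _ := GRing.Linear.on tens_map.

Lemma tens_mapE u v : tens_map (tensor u v) = tensor (f u) (g v).
Proof. exact: tens_liftE. Qed.

End Map.

Section Associator.
Context {U V W : lmodType K}.

Fact tens_assoc_subproof1 (w : W) :
  bilinear_map (fun (u : U) (v : V) => tensor u (tensor v w)).
Proof.
split=> [v|u] a x y; first exact: tensor_linearl.
by rewrite tensor_linearl tensor_linearr.
Qed.

Fact tens_assoc_subproof2 :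
  bilinear_map (fun (x : tens U V) (w : W) =>
                  tens_lift (tens_assoc_subproof1 w) x).
Proof.
split=> [w|x] a y z; first by rewrite linearP.
elim/tens_ind: x => [u v|b x x' IH IH'].
  by rewrite !tens_liftE !tensor_linearr.
rewrite !linearP /= IH IH' !scalerDr !scalerA [b * a]mulrC.
by rewrite -!addrA; congr (_ + _); rewrite addrCA.
Qed.

Definition tens_assoc : tens (tens U V) W -> tens U (tens V W) :=
  tens_lift tens_assoc_subproof2.
HB.instance Definition _ := GRing.Linear.on tens_assoc.

Lemma tens_assocE u v w :
  tens_assoc (tensor (tensor u v) w) = tensor u (tensor v w).
Proof. by rewrite /tens_assoc !tens_liftE. Qed.

End Associator.
End TensorProduct.

Section Lines.
Context {K : fieldType}.
Implicit Types V L : lmodType K.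

Definition finite_dim V := exists n, inhabited (Vector.axiom n V).

(* 0 if [V] is infinite dimensional. *)
Definition dim V : nat := xget 0%N [set n | inhabited (Vector.axiom n V)].

(* The top exterior power; only meaningful for finite dimensional [V]. *)
Definition Det V : Type := subsp (extpow (V := V) (dim V)).
HB.instance Definition _ V := GRing.Lmodule.on (Det V).
HB.instance Definition _ V := SubChoice.on (Det V).

Definition dual V : Type := subsp [set f : V -> K^o | linear f].
HB.instance Definition _ V := GRing.Lmodule.on (dual V).
HB.instance Definition _ V := SubChoice.on (dual V).

Definition generates L (xi : L) := forall x : L, exists c : K, x = c *: xi.

(* The dual generator, determined by [dual_gen xi xi = 1] when [xi] generates a
   line. *)
Definition dual_gen L (xi : L) : dual L :=
  xget 0 [set f : dual L | (val f : L -> K^o) xi = 1].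

End Lines.

Section Determinant.
Context {K : fieldType}.
Implicit Types U V W : lmodType K.

(* Kernel, cokernel and determinant depend on the function [f] alone and not on
   a proof of its linearity, so that both bracketings of a triple composite have
   convertible determinants. *)
Definition kernel U V (f : U -> V) : Type := subsp [set x | f x = 0].
HB.instance Definition _ U V (f : U -> V) := GRing.Lmodule.on (kernel f).
HB.instance Definition _ U V (f : U -> V) := SubChoice.on (kernel f).

Definition cokernel U V (f : U -> V) : Type := quotsp (range f).
HB.instance Definition _ U V (f : U -> V) := GRing.Lmodule.on (cokernel f).

Lemma mem_kernel U V (f : {linear U -> V}) x :
  x \in span [set x | f x = 0] <-> f x = 0.
Proof.
apply: (span_id (A := [set x | f x = 0])) => [|a y z /= fy fz].
  exact: linear0.
by rewrite linearP fy fz scaler0 addr0.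
Qed.

Lemma mem_range U V (f : {linear U -> V}) y :
  y \in span (range f) <-> exists x, f x = y.
Proof.
rewrite span_id; [|by exists 0; rewrite ?linear0|].
  by split=> [[x _ <-]|[x <-]]; exists x.
by move=> a _ _ [x _ <-] [x' _ <-]; exists (a *: x + x'); rewrite ?linearP.
Qed.

Definition DetF U V (f : U -> V) : Type :=
  tens (Det (kernel f)) (dual (Det (cokernel f))).
HB.instance Definition _ U V (f : U -> V) := GRing.Lmodule.on (DetF f).

(* The maps of the exact sequence
     0 -> ker S -> ker TS -> ker T -> coker S -> coker TS -> coker T -> 0,
   in this order. *)
Section ExactSequence.
Context {U V W : lmodType K} (S : {linear U -> V}) (T : {linear V -> W}).

Fact ker_incl_subproof x : S x = 0 -> (T \o S) (idfun x) = 0.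
Proof. by move=> /= ->; rewrite linear0. Qed.

Definition ker_incl : kernel S -> kernel (T \o S) := restr ker_incl_subproof.
HB.instance Definition _ := GRing.Linear.on ker_incl.

Fact ker_push_subproof x : (T \o S) x = 0 -> T (S x) = 0.
Proof. by []. Qed.

Definition ker_push : kernel (T \o S) -> kernel T := restr ker_push_subproof.
HB.instance Definition _ := GRing.Linear.on ker_push.

Definition ker_coker : kernel T -> cokernel S := qproj (range S) \o val.
HB.instance Definition _ := GRing.Linear.on ker_coker.

Fact coker_push_subproof y : range S y -> range (T \o S) (T y).
Proof. by case=> x _ <-; exists x. Qed.

Definition coker_push : cokernel S -> cokernel (T \o S) :=
  qmap coker_push_subproof.
HB.instance Definition _ := GRing.Linear.on coker_push.

Fact coker_proj_subproof z : range (T \o S) z -> range T (idfun z).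
Proof. by case=> x _ <-; exists (S x). Qed.

Definition coker_proj : cokernel (T \o S) -> cokernel T :=
  qmap coker_proj_subproof.
HB.instance Definition _ := GRing.Linear.on coker_proj.

Definition rho : nat :=
  ((dim (kernel S) + dim (kernel (T \o S)))
   * (dim (cokernel T) + dim (cokernel (T \o S))))%N.

(* The formula
     alpha1 (x) (pi_* alpha3 /\ alpha4)^* (x) (alpha3 /\ S_* alpha2) (x) alpha5^*
     |-> (-1)^rho (alpha1 /\ alpha2) (x) (alpha5 /\ T_* alpha4)^*
   for all admissible choices; [kerTS], [kerT], [cokS], [cokTS] and [cokT] are
   the resulting generators, seen as elements of the determinant lines. *)
Definition phi_spec (phi : {linear tens (DetF S) (DetF T) -> DetF (T \o S)}) :=
  forall (alpha1 : Det (kernel S)) (alpha2 : ext (kernel (T \o S)))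
         (alpha3 : ext (kernel T)) (alpha4 : ext (cokernel S))
         (alpha5 : ext (cokernel (T \o S)))
         (kerTS : Det (kernel (T \o S))) (kerT : Det (kernel T))
         (cokS : Det (cokernel S)) (cokTS : Det (cokernel (T \o S)))
         (cokT : Det (cokernel T)),
    homogeneous alpha2 -> homogeneous alpha3 ->
    homogeneous alpha4 -> homogeneous alpha5 ->
    val kerTS = wedge (ext_map ker_incl (val alpha1)) alpha2 ->
    val kerT = wedge alpha3 (ext_map ker_push alpha2) ->
    val cokS = wedge (ext_map ker_coker alpha3) alpha4 ->
    val cokTS = wedge alpha5 (ext_map coker_push alpha4) ->
    val cokT = ext_map coker_proj alpha5 ->
    generates alpha1 -> generates kerTS -> generates kerT ->
    generates cokS -> generates cokTS -> generates cokT ->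
    phi (tensor (tensor alpha1 (dual_gen cokS)) (tensor kerT (dual_gen cokT)))
    = (-1) ^+ rho *: (tensor kerTS (dual_gen cokTS) : DetF (T \o S)).

(* For Fredholm [S] and [T] exactly one linear map satisfies [phi_spec]; the
   default value is only there to make the definition total. *)
Definition phi : {linear tens (DetF S) (DetF T) -> DetF (T \o S)} :=
  if pselect (exists f, phi_spec f) is left h then projT1 (cid h) else \0.

End ExactSequence.
End Determinant.

Variant scalar_kind := RealScalars | ComplexScalars.

Definition scalars (R : realType) (k : scalar_kind) : numFieldType :=
  if k is RealScalars then R else R[i].

Definition conj_scalar (R : realType) (k : scalar_kind) :
    scalars R k -> scalars R k :=
  if k is RealScalars then id else @conjc R.

HB.mixin Record isHilbert (R : realType) (k : scalar_kind) H
    of CompleteNormedModule (scalars R k) H := {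
  inner : H -> H -> scalars R k;
  inner_linear : forall y : H, scalar (inner^~ y);
  inner_conj : forall x y : H, inner y x = conj_scalar (inner x y);
  inner_norm : forall x : H, inner x x = `|x| ^+ 2
}.

#[short(type="hilbertType")]
HB.structure Definition Hilbert (R : realType) (k : scalar_kind) :=
  {H of isHilbert R k H & CompleteNormedModule (scalars R k) H}.

Definition bounded_operator (K : numFieldType) (H H' : normedModType K)
    (T : H -> H') :=
  exists M : K, forall x : H, `|T x| <= M * `|x|.

Definition fredholm (K : numFieldType) (H H' : normedModType K)
    (T : {linear H -> H'}) :=
  [/\ bounded_operator T, finite_dim (kernel T) & finite_dim (cokernel T)].

(* Main.v *)
From HB Require Import structures.
From mathcomp Require Import all_boot all_order all_algebra.
From mathcomp Require Import boolp classical_sets functions reals.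
From mathcomp Require Import topology normed_module complete_normed_module.
From mathcomp Require Import ring.
Require Import Defs.

(** The identity is one of linear algebra, valid for linear maps with finite
    dimensional kernels and cokernels over any field ([phi_assoc]). The reason
    is that a chain U1 -A-> U2 -B-> U3 -C-> U4 is a direct sum of chains of
    identity maps that live on an interval of the indices 1..4 and vanish
    elsewhere. Write [xij] for the vectors of [U_i] which start the summands
    living exactly on i..j. Then the kernel of a composite has as basis the
    images in its source of those [xij] which die under it, its cokernel has
    as basis the images in its target of those [xij] which start after its
    source, and all these families except [x14] are finite. Only these
    relative bases are constructed ([adapted_bases]), by choosing bases of
    subquotients of the [U_i] and transporting them along A, B and C.

    Given bases u of ker S, u ++ v of ker TS, w ++ S v of ker T, w ++ z of
    coker S, y ++ T z of coker TS and y of coker T, and writing [s|t] for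
    (wedge of s) tensor (wedge of t)^*, one has
      [u | w z] (x) [w (S v) | y]  |->  (-1)^(|v||z|) [u v | y (T z)],
    the exponent being congruent to rho mod 2 ([phi_on_bases]). The existence
    of a map satisfying the defining formula for all admissible choices of the
    alpha_i is part of this statement: every choice differs from the one given
    by the bases by scalars which cancel ([phi_spec_on_bases]), because a
    homogeneous alpha complementary to the wedge of p in Det X is a multiple of
    the wedge of a complementary family q, modulo the ideal generated by p
    ([complement_left], [complement_right]), and this ideal disappears under
    every operation of the formula.

    All determinants are lines, so it suffices to evaluate both composites on
      [11 | 22 23 24] (x) [22 12 | 33 34] (x) [33 23 13 | 44].
    Both give [11 12 13 | 44 34 24], the first with the exponent
      ((e + c) h + b e) + (b + c) f
    and the second with
      (b (e + f) + h e) + c (h + f),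
    where b, c, e, f, h are the numbers of vectors in x12, x13, x23, x24, x34;
    the terms b e and h e come from interchanging two blocks between the two
    applications of phi. The two exponents agree. *)

Set Implicit Arguments.
Unset Strict Implicit.
Unset Printing Implicit Defensive.

Import GRing.Theory.

Local Open Scope classical_set_scope.
Local Open Scope ring_scope.

(** * Words in the exterior algebra *)

Definition linear_of (K : fieldType) (U W : lmodType K) (f : U -> W) (fL : linear f) :
  {linear U -> W} := HB.pack f (GRing.isLinear.Build K U W _ f fL).

Lemma linear_fun0 (K : fieldType) (U W : lmodType K) (f : U -> W) :
  linear f -> f 0 = 0.
Proof. by move=> fL; exact: (linear0 (linear_of fL)). Qed.

Lemma linear_funZ (K : fieldType) (U W : lmodType K) (f : U -> W) a x :
  linear f -> f (a *: x) = a *: f x.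
Proof. by move=> fL; exact: (linearZ_LR (linear_of fL)). Qed.

Section Words.
Context {K : fieldType} {V : lmodType K}.
Implicit Types (s t p q : seq V) (x y : V).

Lemma word_zero s t : word (s ++ 0 :: t) = 0.
Proof.
have := word_linear s t (-1) 0 0.
by rewrite scaler0 addr0 scaleN1r addNr.
Qed.

Lemma word_swap s t x y : word (s ++ x :: y :: t) = - word (s ++ y :: x :: t).
Proof.
have addl s' t' u v : word (s' ++ (u + v) :: t') = word (s' ++ u :: t') + word (s' ++ v :: t').
  by have := word_linear s' t' 1 u v; rewrite !scale1r.
apply/eqP; rewrite -addr_eq0; apply/eqP.
have E z : word (s ++ z :: (x + y) :: t) = word (s ++ z :: x :: t) + word (s ++ z :: y :: t).
  by rewrite -(cat_rcons z) addl !cat_rcons.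
by have := word_alt s t (x + y); rewrite addl !E !word_alt add0r addr0.
Qed.

Lemma word_move s t x : word (s ++ x :: t) = (-1) ^+ size s *: word (x :: s ++ t).
Proof.
elim/last_ind: s t => [|s y IH] t; first by rewrite scale1r.
rewrite cat_rcons word_swap IH size_rcons exprS mulN1r scaleNr.
by rewrite cat_rcons.
Qed.

Lemma wedge0r (x : ext V) : wedge x 0 = 0.
Proof. exact/linear_fun0/wedge_linearr. Qed.

Lemma wedgeZl a (x y : ext V) : wedge (a *: x) y = a *: wedge x y.
Proof. exact: (linear_funZ a x (wedge_linearl y)). Qed.

Lemma wedgeZr a (x y : ext V) : wedge x (a *: y) = a *: wedge x y.
Proof. exact: (linear_funZ a y (wedge_linearr x)). Qed.

Lemma word_dup s : ~~ uniq s -> word s = 0.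
Proof.
elim: s => // x s IH /=; rewrite negb_and negbK.
case: (boolP (x \in s)) => [xs _|_ /= us].
  case/splitPr: xs => s1 s2.
  by rewrite -cat1s catA word_move /= -[x :: x :: _]cat0s word_alt scaler0.
by rewrite -cat1s -wedge_word IH // wedge0r.
Qed.

(** Bringing [x] to the front of [s] costs a sign, and the remaining letters
    are handled by induction. *)
Lemma word_perm s t : perm_eq s t -> exists e : bool, word s = (-1) ^+ e *: word t.
Proof.
elim: t s => [|x t IH] s.
  by move=> /perm_size/size0nil->; exists false; rewrite scale1r.
move=> st; have : x \in s by rewrite (perm_mem st) mem_head.
move=> xs; case/splitPr: xs st => s1 s2 st.
have : perm_eq (s1 ++ s2) t.
  by rewrite -(perm_cons x) -(perm_catCA s1 [:: x] s2).
case/IH => e E; exists (odd (size s1) (+) e).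
rewrite word_move -cat1s -wedge_word E wedgeZr wedge_word /= scalerA.
by rewrite signr_addb signr_odd.
Qed.

Lemma word_blocks s t p q :
  word (s ++ t ++ p ++ q) = (-1) ^+ (size t * size p) *: word (s ++ p ++ t ++ q).
Proof.
elim: t s => [|x t IH] s; first by rewrite scale1r.
rewrite cat_cons -cat_rcons IH cat_rcons -[x :: p ++ _]cat1s.
have -> : s ++ x :: p ++ t ++ q = s ++ ((x :: p) ++ t ++ q) by [].
rewrite -!wedge_word.
have -> : word (x :: p) = (-1) ^+ size p *: word (p ++ [:: x]).
  by rewrite word_move cats0 scalerA -exprD addnn -mul2n exprM sqrrN expr1n expr1n scale1r.
by rewrite wedgeZl wedgeZr scalerA -exprD !wedge_word -!catA mulSn addnC.
Qed.
End Words.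

(** * The top exterior power *)

Section TopPower.
Context {K : fieldType} {V : lmodType K}.
Implicit Types (s t p q b : seq V) (x y : V).

(** The ideal generated by the letters of [p], presented by its words so that
    linear maps can be tested on them. *)
Definition letter_ideal p : {pred ext V} :=
  span [set z | exists s a t, a \in p /\ z = word (s ++ a :: t)].

Lemma letter_ideal_ker (W : lmodType K) p (f : ext V -> W) (z : ext V) :
  linear f -> (forall s a t, a \in p -> f (word (s ++ a :: t)) = 0) ->
  z \in letter_ideal p -> f z = 0.
Proof.
move=> fL f0 /spanP; elim=> [|c v w [s [a [t [ap ->]]]] _ IH].
  exact: linear_fun0.
by rewrite fL f0 // IH scaler0 addr0.
Qed.

Lemma wedge_letterl p z : z \in letter_ideal p -> wedge (word p) z = 0.
Proof.
apply: letter_ideal_ker => [|s a t ap]; first exact: wedge_linearr.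
rewrite wedge_word word_dup // cat_uniq negb_and; apply/orP; right.
by rewrite negb_and negbK; apply/orP; left; apply/hasP; exists a; rewrite ?mem_cat ?mem_head ?orbT.
Qed.

Lemma wedge_letterr p z : z \in letter_ideal p -> wedge z (word p) = 0.
Proof.
apply: (letter_ideal_ker (f := fun z => wedge z (word p))) => [|s a t ap]; first exact: wedge_linearl.
rewrite wedge_word word_dup // cat_uniq negb_and; apply/orP; right.
by rewrite negb_and negbK; apply/orP; left; apply/hasP; exists a; rewrite ?mem_cat ?mem_head ?orbT.
Qed.

Lemma ext_map_letter (W : lmodType K) (g : {linear V -> W}) p z :
  (forall x, x \in p -> g x = 0) -> z \in letter_ideal p -> ext_map g z = 0.
Proof.
move=> g0; apply: letter_ideal_ker => [|s a t ap]; first exact: linearP.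
by rewrite ext_map_word map_cat /= g0 // word_zero.
Qed.

(** Expanding one letter at a time: [s] holds the letters already replaced by
    elements of [b]. *)
Lemma word_expand b s t : (forall x, x \in span [set y | y \in b]) ->
  {subset s <= b} ->
  word (s ++ t) \in
    span [set word r | r in [set r | size r = (size s + size t)%N /\ {subset r <= b}]].
Proof.
move=> bV; elim: t s => [|x t IH] s sb.
  by rewrite cats0; apply: mem_span; exists s; rewrite /= ?addn0.
move/spanP: (bV x); elim=> [|c v w vb _ IHw]; first by rewrite word_zero rpred0.
rewrite word_linear rpredD // rpredZ // -cat_rcons.
have := IH (rcons s v); rewrite size_rcons addSnnS; apply.
by move=> u; rewrite mem_rcons inE => /predU1P[->|/sb].
Qed.

(** The words in the letters of [p ++ q] span. Such a word of length [size q]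
    either contains a letter of [p], or repeats a letter and vanishes, or is a
    permutation of [q]. The argument is one of spanning only and computes no
    determinant. *)
Lemma extpow_mod_letters p q (z : ext V) :
  (forall x, x \in span [set y | y \in p ++ q]) ->
  z \in span (extpow (V := V) (size q)) ->
  exists c, z - c *: word q \in letter_ideal p.
Proof.
move=> pqV /spanP; elim=> [|a _ z' [s /= sq <-] _ [c' IH]].
  by exists 0; rewrite scale0r subr0 rpred0.
suff [c Hc] : exists c, word s - c *: word q \in letter_ideal p.
  exists (a * c + c'); rewrite scalerDl -scalerA opprD addrACA -scalerBr.
  by rewrite rpredD // rpredZ.
have := word_expand s pqV (s := [::]) (fun _ => ltac:(by [])).
rewrite /= add0n sq => /spanP; elim=> [|{}a _ {}z' [r /= [rq rs] <-] _ [{}c' {}IH]].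
  by exists 0; rewrite scale0r subr0 rpred0.
suff [c Hc] : exists c, word r - c *: word q \in letter_ideal p.
  exists (a * c + c'); rewrite scalerDl -scalerA opprD addrACA -scalerBr.
  by rewrite rpredD // rpredZ.
case: (boolP (has (mem p) r)) => [/hasP[x xr xp]|/hasPn rp].
  exists 0; rewrite scale0r subr0; apply: mem_span.
  by case/splitPr: xr => r1 r2; exists r1, x, r2.
case: (boolP (uniq r)) => ur; last by exists 0; rewrite word_dup // scale0r subr0 rpred0.
have rsub : {subset r <= q}.
  move=> x xr; have /negPf xp : x \notin p := rp x xr.
  by have := rs x xr; rewrite mem_cat xp.
have [_ eqi] := uniq_min_size ur rsub (eq_leq (esym rq)).
have uq := leq_size_uniq ur rsub (eq_leq (esym rq)).
have [e ->] := word_perm (uniq_perm ur uq eqi).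
by exists ((-1) ^+ e); rewrite subrr rpred0.
Qed.

Section Volume.
Variables (n : nat) (v2r : {linear V -> 'rV[K]_n}).

(** The determinant of the coordinates, extended by zero to the words of
    length different from [n]: it is what makes the top exterior power nonzero
    and separates it from the other degrees. *)
Definition volume s : K^o :=
  if size s == n then \det (\matrix_(i < n, j < n) v2r (nth 0 s i) 0 j) else 0.

Lemma volume_alternating : alternating_word_map volume.
Proof.
have nthE s t x y i : i != size s -> nth 0 (s ++ x :: t) i = nth 0 (s ++ y :: t) i.
  rewrite !nth_cat; case: ltngtP => //= lt _.
  by rewrite -subn_gt0 in lt; case: (i - size s)%N lt.
have nthS s t x : nth 0 (s ++ x :: t) (size s) = x by rewrite nth_cat ltnn subnn.
split=> [s t a x y|s t x]; rewrite /volume !size_cat /=; case: eqP => [E|_].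
- have lt : (size s < n)%N by rewrite -E addnS ltnS leq_addr.
  rewrite -[in RHS]/(_ * _) -[X in _ = _ + X]mul1r.
  apply: (determinant_multilinear (i0 := Ordinal lt)).
  + by apply/rowP => j; rewrite !mxE /= !nthS linearP !mxE mul1r.
  + apply/matrixP => i j; rewrite !mxE (nthE _ _ _ (a *: x + y)) //.
    by have := neq_lift (Ordinal lt) i; rewrite -val_eqE eq_sym.
  + apply/matrixP => i j; rewrite !mxE (nthE _ _ _ (a *: x + y)) //.
    by have := neq_lift (Ordinal lt) i; rewrite -val_eqE eq_sym.
- by rewrite scaler0 addr0.
- have lt1 : ((size s).+1 < n)%N by rewrite -E addnS !ltnS addnS ltnS leq_addr.
  have lt := ltnW lt1.
  apply: (@determinant_alternate _ _ _ (Ordinal lt) (Ordinal lt1)).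
    by rewrite -val_eqE /= neq_ltn ltnSn.
  by move=> j; rewrite !mxE /= nthS -cat_rcons -[(size s).+1](size_rcons s x) nthS.
- by [].
Qed.

Lemma volume_extpow k z : z \in span (extpow (V := V) k) ->
  k <> n -> ext_lift volume_alternating z = 0.
Proof.
move=> /spanP zk kn; elim: zk => [|a _ w [s /= sk <-] _ IH]; first exact: linear0.
rewrite linearP /= IH addr0 ext_liftE /volume sk.
by case: eqP; rewrite ?scaler0.
Qed.
End Volume.
End TopPower.

(** * Lines, their duals and tensor products *)

Section Lines.
Context {K : fieldType}.
Implicit Types V L M W : lmodType K.

(** A basis of a one dimensional space, given together with its coordinate
    function; unlike [generates], this excludes [xi = 0]. *)
Definition line L (xi : L) :=
  exists2 f : {linear L -> K^o}, f xi = 1 & forall x, x = f x *: xi.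

Lemma line_generates L (xi : L) : line xi -> generates xi.
Proof. by case=> f _ fE x; exists (f x). Qed.

Lemma line_generator L (xi eta : L) :
  line xi -> generates eta -> exists2 c, c != 0 & eta = c *: xi.
Proof.
case=> f f1 fE geta; exists (f eta); last exact: fE.
apply/eqP => f0; have [c E] := geta xi.
by have := f1; rewrite E linearZ /= f0 scaler0 => /eqP; rewrite eq_sym oner_eq0.
Qed.

Lemma line_neq0 L (xi : L) : line xi -> xi != 0.
Proof.
case=> f f1 _; apply/eqP => xi0.
by have := f1; rewrite xi0 linear0 => /eqP; rewrite eq_sym oner_eq0.
Qed.

Lemma line_extend L W (xi : L) (w : W) : line xi ->
  exists F : {linear L -> W}, F xi = w.
Proof.
case=> f f1 _; have fL : linear (fun x => (f x : K) *: w).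
  by move=> a x y; rewrite linearP scalerDl scalerA.
by exists (linear_of fL); rewrite /= f1 scale1r.
Qed.

Lemma mem_dual L (f : L -> K^o) : f \in span [set f : L -> K^o | linear f] <-> linear f.
Proof.
apply: (span_id (A := [set f : L -> K^o | linear f])) => [|a g h /= gL hL] b x y.
  by rewrite scaler0 addr0.
rewrite -[LHS]/(a *: g (b *: x + y) + h (b *: x + y)).
rewrite -[RHS]/(b *: (a *: g x + h x) + (a *: g y + h y)) gL hL.
by rewrite !scalerDr !scalerA [b * a]mulrC addrACA.
Qed.

Lemma dual_linear L (f : dual L) : linear (val f).
Proof. by apply/mem_dual/(valP f). Qed.

Lemma dual_valZ L (a : K) (f : dual L) x : val (a *: f) x = a * val f x.
Proof. by rewrite linearZ. Qed.

Lemma dual_eval_linear L (x : L) : linear (fun f : dual L => val f x : K^o).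
Proof. by move=> a f g; rewrite linearP. Qed.

Lemma dual_gen1 L (xi : L) : line xi -> val (dual_gen xi) xi = 1.
Proof.
case=> f f1 fE; rewrite /dual_gen; case: xgetP => [g -> //|/=].
have /mem_dual fd : linear (f : L -> K^o) by exact: linearP.
by move/(_ (Sub (f : L -> K^o) fd)).
Qed.

Lemma line_dual L (xi : L) : line xi -> line (dual_gen xi).
Proof.
move=> lxi; have [f f1 fE] := lxi.
exists (linear_of (dual_eval_linear xi)); first exact: dual_gen1.
move=> g; apply: val_inj; apply/funext => x.
rewrite [X in _ = X]dual_valZ (fE x) !(linear_funZ _ _ (dual_linear _)) /= dual_gen1 //.
by rewrite /GRing.scale /= mulr1 mulrC.
Qed.

Lemma dual_genZ L (xi : L) c : line xi -> c != 0 ->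
  dual_gen (c *: xi) = c^-1 *: dual_gen xi.
Proof.
move=> lxi c0; have [f f1 fE] := lxi.
have lc : line (c *: xi).
  have fL : linear (fun x => c^-1 * f x : K^o).
    by move=> a x y; rewrite linearP mulrDr /GRing.scale /= mulrCA.
  exists (linear_of fL) => [|x] /=.
    by rewrite linearZ /= f1 /GRing.scale /= mulr1 mulVf.
  by rewrite scalerA mulrAC mulVf // mul1r -fE.
have [g g1 gE] := line_dual lxi.
rewrite [LHS]gE; congr (_ *: _).
have := dual_gen1 lc; rewrite [dual_gen (c *: xi)]gE dual_valZ.
have -> : val (dual_gen xi) (c *: xi) = c.
  by rewrite (linear_funZ _ _ (dual_linear _)) dual_gen1 // /GRing.scale /= mulr1.
by rewrite -gE => E; rewrite -[RHS]mul1r -E mulfK.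
Qed.

Lemma tensorZl L M (a : K) (x : L) (y : M) : tensor (a *: x) y = a *: tensor x y.
Proof. exact: (linear_funZ a x (tensor_linearl y)). Qed.

Lemma tensorZr L M (a : K) (x : L) (y : M) : tensor x (a *: y) = a *: tensor x y.
Proof. exact: (linear_funZ a y (tensor_linearr x)). Qed.

Lemma tensorZZ L M (a b : K) (x : L) (y : M) :
  tensor (a *: x) (b *: y) = (a * b) *: tensor x y.
Proof. by rewrite (tensorZl a x) (tensorZr b x y) scalerA. Qed.

Lemma line_tensor L M (xi : L) (eta : M) : line xi -> line eta -> line (tensor xi eta).
Proof.
case=> f f1 fE [g g1 gE].
have bP : bilinear_map (fun x y => f x * g y : K^o).
  split=> [y|x] a u v; rewrite linearP /GRing.scale /=.
    by rewrite mulrDl mulrA.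
  by rewrite mulrDr mulrCA.
exists (tens_lift bP : {linear _ -> _}) => [|x]; first by rewrite /= tens_liftE f1 g1 mulr1.
elim/(@tens_ind K L M): x => [x y|a x y IHx IHy].
  by rewrite /= tens_liftE [in LHS](fE x) [in LHS](gE y) tensorZZ.
by rewrite linearP scalerDl -scalerA -IHx -IHy.
Qed.
End Lines.

(** * Determinant lines of finite dimensional spaces *)

Section Basis.
Context {K : fieldType} {V : lmodType K}.
Implicit Types (s t p q b : seq V) (x y : V).

(** Invariance of dimension: two inverse isomorphisms give matrices A, B with
    A B = 1, which forces n <= m. *)
Lemma vector_axiom_le (n m : nat) : Vector.axiom n V -> Vector.axiom m V -> (n <= m)%N.
Proof.
case=> f fL [f' fK f'K] [g gL [g' gK g'K]].
pose F := linear_of fL; pose G := linear_of gL.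
have f'L : linear f' by exact: (can2_linear (f := F)).
have g'L : linear g' by exact: (can2_linear (f := G)).
pose h := linear_of f'L; pose h' := linear_of g'L.
pose A := lin1_mx (G \o h); pose B := lin1_mx (F \o h').
apply: (@mulmx1_min _ _ _ A B).
apply/row_matrixP => i; rewrite !rowE mulmxA mul_rV_lin1 mulmx1.
by rewrite mul_rV_lin1 /= gK f'K.
Qed.

Lemma dim_axiom (n : nat) : Vector.axiom n V -> dim V = n.
Proof.
move=> Vn; rewrite /dim; case: xgetP => [m _ [Vm]|]; last by move/(_ n); case; split.
by apply/eqP; rewrite eqn_leq !vector_axiom_le.
Qed.

(** The first clause fixes the number of elements, the second one says that
    they span; this form is stable under permutation. *)
Definition basis b :=
  inhabited (Vector.axiom (size b) V) /\ forall x, x \in span [set y | y \in b].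

Lemma basis_dim b : basis b -> dim V = size b.
Proof. by case=> [[ax] _]; apply: dim_axiom. Qed.

Lemma basis_perm b c : perm_eq b c -> basis b -> basis c.
Proof.
move=> bc [bax bV]; split; first by rewrite -(perm_size bc).
move=> x; have := bV x; congr (_ \in span _).
by apply/funext => y; rewrite /mkset (perm_mem bc).
Qed.

Lemma extpow_basis b z : basis b -> z \in span (extpow (V := V) (size b)) ->
  exists c, z = c *: word b.
Proof.
case=> _ bV /(extpow_mod_letters (p := [::]) bV) [c zc]; exists c.
apply/eqP; rewrite -subr_eq0; apply/eqP.
exact: (letter_ideal_ker (f := idfun) _ _ zc).
Qed.

Lemma mem_extpow s : word s \in span (extpow (V := V) (size s)).
Proof. by apply: mem_span; exists s. Qed.

(** The determinant functional takes the value 1 on the standard basis, whose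
    word is a multiple of [word b]; hence it does not vanish on [word b]. *)
Lemma volume_form b : basis b -> exists D : {linear ext V -> K^o},
  D (word b) != 0 /\
  forall k z, z \in span (extpow (V := V) k) -> k <> size b -> D z = 0.
Proof.
move=> bb; have [[ax] _] := bb; case: ax => f fL [f' fK f'K].
pose F := linear_of fL.
exists (ext_lift (volume_alternating F)); split; last first.
  by move=> k z zk kb; apply: volume_extpow zk kb.
pose e := [seq f' (delta_mx 0 i) | i <- enum 'I_(size b)].
have se : size e = size b by rewrite size_map size_enum_ord.
have [c E] : exists c, word e = c *: word b.
  by apply: extpow_basis => //; rewrite -se mem_extpow.
have D1 : ext_lift (volume_alternating F) (word e) = 1.
  rewrite ext_liftE /volume se eqxx -[RHS](det1 _ (size b)); congr (\det _).
  apply/matrixP => i j; rewrite !mxE (nth_map i) ?size_enum_ord // nth_ord_enum.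
  by rewrite /= f'K !mxE eqxx eq_sym.
apply/eqP => D0; move: D1; rewrite E linearZ /= D0 scaler0 => /eqP.
by rewrite eq_sym oner_eq0.
Qed.

(** A nonzero multiple of [word b] is detected by the volume form, which
    vanishes in all other degrees. *)
Lemma extpow_top_degree b k z : basis b -> z != 0 ->
  z \in span (extpow (V := V) (size b)) -> z \in span (extpow (V := V) k) -> k = size b.
Proof.
move=> bb z0 zb zk; apply/eqP; apply: contraNT z0 => /eqP kb.
have [c E] := extpow_basis bb zb; have [D [Db D0]] := volume_form bb.
have /eqP := D0 _ _ zk kb; rewrite E linearZ /= mulf_eq0 (negPf Db) orbF.
by move/eqP->; rewrite scale0r.
Qed.

Definition det_word b : Det V := insubd 0 (word b).

Lemma val_det_word b : size b = dim V -> val (det_word b) = word b.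
Proof. by move=> bV; rewrite /det_word insubdK // -bV; apply: mem_extpow. Qed.

Lemma line_det_word b : basis b -> line (det_word b).
Proof.
move=> bb; have [D [Db _]] := volume_form bb; have dV := basis_dim bb.
have vb : val (det_word b) = word b by apply: val_det_word.
have fL : linear (fun x : Det V => D (val x) / D (word b) : K^o).
  by move=> a x y; rewrite !linearP mulrDl /GRing.scale /= mulrA.
exists (linear_of fL) => [|x] /=; first by rewrite vb mulfV.
apply: val_inj; rewrite [RHS]linearZ /= vb.
have : val x \in span (extpow (V := V) (size b)) by rewrite -dV; apply: valP.
case/(extpow_basis bb) => c E; rewrite E linearZ /=.
by rewrite /GRing.scale /= mulfK.
Qed.

End Basis.

(** * Homogeneous complements of a word *)

Section Complement.
Context {K : fieldType} {V : lmodType K}.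
Implicit Types (p q : seq V) (alpha : ext V).

Lemma wedge_extpow p alpha k : alpha \in span (extpow (V := V) k) ->
  wedge (word p) alpha \in span (extpow (V := V) (size p + k)) /\
  wedge alpha (word p) \in span (extpow (V := V) (k + size p)).
Proof.
move/spanP; elim=> [|a _ z [s /= sk <-] _ [IH1 IH2]].
  by rewrite wedge0r (linear_fun0 (wedge_linearl _)) !rpred0.
rewrite wedge_linearr wedge_linearl !wedge_word.
by split; rewrite rpredD ?rpredZ // -sk -size_cat mem_extpow.
Qed.

(** Being nonzero of top degree forces [alpha] to have degree [size q], even
    though [alpha] need not be decomposable. *)
Lemma complement_left p q alpha c :
  basis (p ++ q) -> homogeneous alpha ->
  c *: wedge (word p) alpha != 0 ->
  c *: wedge (word p) alpha \in span (extpow (V := V) (size (p ++ q))) ->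
  exists d, alpha - d *: word q \in letter_ideal p.
Proof.
move=> pq [k ak] z0 zpq; apply: extpow_mod_letters; first by case: pq.
have [zk _] := wedge_extpow p ak.
have := extpow_top_degree pq z0 zpq (rpredZ c zk).
by rewrite size_cat => /addnI <-.
Qed.

Lemma complement_right p q alpha c :
  basis (q ++ p) -> homogeneous alpha ->
  c *: wedge alpha (word p) != 0 ->
  c *: wedge alpha (word p) \in span (extpow (V := V) (size (q ++ p))) ->
  exists d, alpha - d *: word q \in letter_ideal p.
Proof.
move=> qp [k ak] z0 zqp; apply: extpow_mod_letters.
  by have [] : basis (p ++ q) by apply: basis_perm qp; rewrite perm_catC.
have [_ zk] := wedge_extpow p ak.
have := extpow_top_degree qp z0 zqp (rpredZ c zk).
by rewrite size_cat => /addIn <-.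
Qed.

(** Multiplying by [word p] kills the ideal generated by [p], so that [alpha]
    may be replaced by its representative [d *: word q]. *)
Lemma mod_letters p q alpha d : alpha - d *: word q \in letter_ideal p ->
  wedge (word p) alpha = d *: word (p ++ q) /\
  wedge alpha (word p) = d *: word (q ++ p).
Proof.
move=> ap; rewrite -[alpha](subrK (d *: word q)) [_ + _]addrC; split.
  by rewrite wedge_linearr (wedge_letterl ap) addr0 wedge_word.
by rewrite wedge_linearl (wedge_letterr ap) addr0 wedge_word.
Qed.

Lemma ext_map_mod_letters (U : eqType) (W : lmodType K) (g : {linear V -> W})
    (k : U -> V) (k' : U -> W) (p q : seq U) alpha d :
  alpha - d *: word (map k q) \in letter_ideal (map k p) ->
  {in p, forall x, g (k x) = 0} -> {in q, forall x, g (k x) = k' x} ->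
  ext_map g alpha = d *: word (map k' q).
Proof.
move=> ap gp gq; rewrite -[alpha](subrK (d *: word (map k q))) addrC.
rewrite linearP /= (ext_map_letter _ ap) => [|_ /mapP[x xp ->]]; last exact: gp.
rewrite addr0 ext_map_word -map_comp; congr (_ *: word _).
by apply/eq_in_map => x /gq.
Qed.

Lemma det_word_eq p (xi : Det V) c : basis p -> val xi = c *: word p -> xi = c *: det_word p.
Proof.
move=> bp E; apply: val_inj.
by rewrite [RHS]linearZ /= val_det_word ?E // (basis_dim bp).
Qed.
End Complement.

(** * The isomorphism phi on adapted bases *)

Section FredholmBases.
Context {K : fieldType}.
Implicit Types U V W : lmodType K.

(** Total, with value 0 outside of the kernel, so that it can be mapped over
    sequences of vectors. *)
Definition to_kernel U V (f : U -> V) (x : U) : kernel f := insubd 0 x.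

Lemma val_to_kernel U V (f : U -> V) x : f x = 0 -> val (to_kernel f x) = x.
Proof. by move=> fx; rewrite /to_kernel insubdK //; apply: mem_span. Qed.

Definition kernel_basis U V (f : U -> V) (s : seq U) :=
  (forall x, x \in s -> f x = 0) /\ basis (map (to_kernel f) s).
Definition cokernel_basis U V (f : U -> V) (t : seq V) := basis (map (qproj (range f)) t).

Definition det_kernel U V (f : U -> V) s : Det (kernel f) := det_word (map (to_kernel f) s).
Definition det_cokernel U V (f : U -> V) t : Det (cokernel f) := det_word (map (qproj (range f)) t).

(** The generator written [s|t] in the introduction. *)
Definition detF_gen U V (f : U -> V) (s : seq U) (t : seq V) : DetF f :=
  tensor (det_kernel f s) (dual_gen (det_cokernel f t)).

Lemma kernel_basis_perm U V (f : U -> V) s t : perm_eq s t -> kernel_basis f s -> kernel_basis f t.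
Proof.
move=> st [f0 bs]; split; first by move=> x; rewrite -(perm_mem st); apply: f0.
by apply: basis_perm bs; apply: perm_map.
Qed.

Lemma cokernel_basis_perm U V (f : U -> V) s t : perm_eq s t -> cokernel_basis f s -> cokernel_basis f t.
Proof. by move=> st; apply: basis_perm; apply: perm_map. Qed.

Lemma line_detF_gen U V (f : U -> V) s t : kernel_basis f s -> cokernel_basis f t -> line (detF_gen f s t).
Proof.
by move=> [_ ks] ct; apply: line_tensor; [|apply: line_dual]; apply: line_det_word.
Qed.

Lemma val_det_kernel U V (f : U -> V) s : kernel_basis f s -> val (det_kernel f s) = word (map (to_kernel f) s).
Proof. by move=> [_ ks]; rewrite val_det_word // (basis_dim ks). Qed.

Lemma val_det_cokernel U V (f : U -> V) t : cokernel_basis f t ->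
  val (det_cokernel f t) = word (map (qproj (range f)) t).
Proof. by move=> ct; rewrite val_det_word // (basis_dim ct). Qed.

Lemma qproj0 V (A : set V) x : A x -> qproj A x = 0.
Proof. by move=> Ax; rewrite -(linear0 (qproj A)); apply/qproj_eq; rewrite subr0 mem_span. Qed.

Lemma val_generator_neq0 V (xi eta : Det V) : line xi -> generates eta -> val eta != 0.
Proof.
move=> lxi geta; have [c c0 ->] := line_generator lxi geta.
have : c *: xi != 0 by rewrite scaler_eq0 negb_or c0 line_neq0.
by apply: contraNneq => v0; apply/eqP/val_inj; rewrite v0 linear0.
Qed.

(** The scalars by which two admissible choices of generators in the formula
    for phi differ: [c1] comes from alpha1 and [di] from the i-th factor
    alpha_i. They enter both sides through the same product. *)
Lemma scale_generators (L1 L2 L3 L4 M1 M2 : lmodType K)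
    (F : {linear tens (tens L1 (dual L2)) (tens L3 (dual L4)) -> tens M1 (dual M2)})
    x1 x2 x3 x4 y1 y2 (e c1 d2 d3 d4 d5 : K) :
  line x2 -> line x4 -> line y2 -> d3 * d4 != 0 -> d4 * d5 != 0 ->
  F (tensor (tensor x1 (dual_gen x2)) (tensor x3 (dual_gen x4))) =
    e *: tensor y1 (dual_gen y2) ->
  F (tensor (tensor (c1 *: x1) (dual_gen ((d3 * d4) *: x2)))
            (tensor ((d2 * d3) *: x3) (dual_gen (d5 *: x4)))) =
    e *: tensor ((c1 * d2) *: y1) (dual_gen ((d4 * d5) *: y2)).
Proof.
move=> l2 l4 m2 d34 d45 FE; move: (d34) (d45).
rewrite !mulf_eq0 !negb_or => /andP[d30 d40] /andP[_ d50].
rewrite (dual_genZ l2 d34) (dual_genZ l4 d50) (dual_genZ m2 d45).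
rewrite (tensorZZ c1 _ x1) (tensorZZ (d2 * d3) _ x3) (tensorZZ (c1 * d2) _ y1).
rewrite (tensorZZ _ _ (tensor x1 _)) linearZ_LR FE !scalerA.
by congr (_ *: _); field; rewrite d30 d40 d50.
Qed.

Section Phi.
Context {U V W : lmodType K} (S : {linear U -> V}) (T : {linear V -> W}).

Lemma ker_incl_to_kernel x : S x = 0 -> ker_incl T (to_kernel S x) = to_kernel (T \o S) x.
Proof.
move=> Sx; apply: val_inj; rewrite val_to_kernel /= ?Sx ?linear0 //.
by rewrite val_to_kernel.
Qed.

Lemma ker_push_to_kernel x : T (S x) = 0 -> ker_push (to_kernel (T \o S) x) = to_kernel T (S x).
Proof. by move=> TSx; apply: val_inj; rewrite /= !val_to_kernel. Qed.

Lemma ker_coker_to_kernel x : T x = 0 -> ker_coker S (to_kernel T x) = qproj (range S) x.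
Proof. by move=> Tx; rewrite /ker_coker /= val_to_kernel. Qed.

Lemma coker_push_qproj x : coker_push T (qproj (range S) x) = qproj (range (T \o S)) (T x).
Proof. by rewrite /coker_push /qmap qliftE. Qed.

Lemma coker_proj_qproj x : coker_proj (qproj (range (T \o S)) x) = qproj (range T) x.
Proof. by rewrite /coker_proj /qmap qliftE. Qed.

Lemma to_kernel0 : to_kernel T 0 = 0.
Proof. by apply: val_inj; rewrite val_to_kernel ?linear0. Qed.

Lemma map_ker_incl (s : seq U) : {in s, forall x, S x = 0} ->
  map (ker_incl T) (map (to_kernel S) s) = map (to_kernel (T \o S)) s.
Proof.
by move=> s0; rewrite -map_comp; apply/eq_in_map => x /s0; apply: ker_incl_to_kernel.
Qed.

Lemma map_ker_push (s : seq U) : {in s, forall x, T (S x) = 0} ->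
  map (ker_push (S := S) (T := T)) (map (to_kernel (T \o S)) s) = map (to_kernel T) (map S s).
Proof.
by move=> s0; rewrite -!map_comp; apply/eq_in_map => x /s0; apply: ker_push_to_kernel.
Qed.

Lemma map_ker_coker (s : seq V) : {in s, forall x, T x = 0} ->
  map (ker_coker S (T := T)) (map (to_kernel T) s) = map (qproj (range S)) s.
Proof.
by move=> s0; rewrite -map_comp; apply/eq_in_map => x /s0; apply: ker_coker_to_kernel.
Qed.

Lemma map_coker_push (s : seq V) :
  map (coker_push (S := S) T) (map (qproj (range S)) s) =
  map (qproj (range (T \o S))) (map T s).
Proof. by rewrite -!map_comp; apply: eq_map => x; apply: coker_push_qproj. Qed.

Lemma map_coker_proj (s : seq W) :
  map (coker_proj (S := S) (T := T)) (map (qproj (range (T \o S))) s) =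
  map (qproj (range T)) s.
Proof. by rewrite -map_comp; apply: eq_map => x; apply: coker_proj_qproj. Qed.

Variables (u v : seq U) (w z : seq V) (y : seq W).
Hypotheses (kS : kernel_basis S u) (kTS : kernel_basis (T \o S) (u ++ v))
  (kT : kernel_basis T (w ++ map S v)) (cS : cokernel_basis S (w ++ z))
  (cTS : cokernel_basis (T \o S) (y ++ map T z)) (cT : cokernel_basis T y).

(** The dimensions of ker S and of coker T occur twice in the factors of
    [rho], leaving |v| and |z|. *)
Lemma rho_parity : (-1) ^+ rho S T = (-1) ^+ (size v * size z) :> K.
Proof.
rewrite /rho (basis_dim kS.2) (basis_dim kTS.2) (basis_dim cT) (basis_dim cTS).
rewrite !size_map !size_cat size_map -signr_odd -[RHS]signr_odd.
by rewrite !oddM !oddD !addKb.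
Qed.

(** The exact sequence is traversed from left to right. At each place the
    previous step has put one of the two factors of a generator in the form
    (scalar) * (word), so that its complement alpha_i equals [di] times a word
    modulo the letters of the first factor; these letters are mapped to 0 by
    the next map of the sequence. *)
Lemma phi_spec_on_bases (F : {linear tens (DetF S) (DetF T) -> DetF (T \o S)}) :
  F (tensor (detF_gen S u (w ++ z)) (detF_gen T (w ++ map S v) y)) =
    (-1) ^+ rho S T *: detF_gen (T \o S) (u ++ v) (y ++ map T z) ->
  phi_spec F.
Proof.
move=> FE alpha1 alpha2 alpha3 alpha4 alpha5 kerTS kerT cokS cokTS cokT.
move=> h2 h3 h4 h5 EkTS EkT EcS EcTS EcT g1 gkTS gkT gcS gcTS gcT.
have [c1 c10 E1] := line_generator (line_det_word kS.2) g1.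
have Sx0 x : x \in u -> S x = 0 by apply: kS.1.
have TSx0 x : x \in u ++ v -> T (S x) = 0 by apply: kTS.1.
have Tx0 x : x \in w ++ map S v -> T x = 0 by apply: kT.1.
(* In ker TS: alpha2 complements the wedge of u. *)
have {}EkTS : val kerTS = c1 *: wedge (word (map (to_kernel (T \o S)) u)) alpha2.
  rewrite EkTS E1 linearZ /= val_det_kernel // ext_map_word wedgeZl.
  by rewrite (map_ker_incl kS.1).
have [d2 a2] :
    exists d, alpha2 - d *: word (map (to_kernel (T \o S)) v) \in letter_ideal (map (to_kernel (T \o S)) u).
  have := kTS.2; rewrite map_cat => b; apply: (complement_left (c := c1) b h2).
    by rewrite -EkTS (val_generator_neq0 (line_det_word kTS.2) gkTS).
  by rewrite -EkTS -map_cat -(basis_dim kTS.2); apply: valP.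
have {}EkTS : kerTS = (c1 * d2) *: det_kernel (T \o S) (u ++ v).
  by apply: (det_word_eq kTS.2); rewrite EkTS (mod_letters a2).1 -map_cat scalerA.
(* In ker T: alpha3 complements the wedge of S v, and S kills u. *)
have {}EkT : val kerT = d2 *: wedge alpha3 (word (map (to_kernel T) (map S v))).
  have pu : {in u, forall x, ker_push (to_kernel (T \o S) x) = 0}.
    by move=> x xu; rewrite ker_push_to_kernel Sx0 ?linear0 ?to_kernel0.
  have pv : {in v, forall x, ker_push (to_kernel (T \o S) x) = (to_kernel T \o S) x}.
    by move=> x xv; rewrite ker_push_to_kernel // TSx0 // mem_cat xv orbT.
  by rewrite EkT (ext_map_mod_letters a2 pu pv) wedgeZr map_comp.
have [d3 a3] :
    exists d, alpha3 - d *: word (map (to_kernel T) w) \in letter_ideal (map (to_kernel T) (map S v)).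
  have := kT.2; rewrite map_cat => b; apply: (complement_right (c := d2) b h3).
    by rewrite -EkT (val_generator_neq0 (line_det_word kT.2) gkT).
  by rewrite -EkT -map_cat -(basis_dim kT.2); apply: valP.
have {}EkT : kerT = (d2 * d3) *: det_kernel T (w ++ map S v).
  by apply: (det_word_eq kT.2); rewrite EkT (mod_letters a3).2 -map_cat scalerA.
(* In coker S: alpha4 complements the wedge of w, and S v vanishes modulo im S. *)
have {}EcS : val cokS = d3 *: wedge (word (map (qproj (range S)) w)) alpha4.
  have pv : {in map S v, forall x, ker_coker S (to_kernel T x) = 0}.
    move=> _ /mapP[x xv ->]; rewrite ker_coker_to_kernel; first by apply: qproj0; exists x.
    by rewrite TSx0 // mem_cat xv orbT.
  have pw : {in w, forall x, ker_coker S (to_kernel T x) = qproj (range S) x}.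
    by move=> x xw; rewrite ker_coker_to_kernel // Tx0 // mem_cat xw.
  by rewrite EcS (ext_map_mod_letters a3 pv pw) wedgeZl.
have [d4 a4] :
    exists d, alpha4 - d *: word (map (qproj (range S)) z) \in letter_ideal (map (qproj (range S)) w).
  have := cS; rewrite /cokernel_basis map_cat => b; apply: (complement_left (c := d3) b h4).
    by rewrite -EcS (val_generator_neq0 (line_det_word cS) gcS).
  by rewrite -EcS -map_cat -(basis_dim cS); apply: valP.
have {}EcS : cokS = (d3 * d4) *: det_cokernel S (w ++ z).
  by apply: (det_word_eq cS); rewrite EcS (mod_letters a4).1 -map_cat scalerA.
(* In coker TS: alpha5 complements the wedge of T z, and T kills w. *)
have {}EcTS : val cokTS = d4 *: wedge alpha5 (word (map (qproj (range (T \o S))) (map T z))).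
  have pw : {in w, forall x, coker_push T (qproj (range S) x) = 0}.
    by move=> x xw; rewrite coker_push_qproj Tx0 ?linear0 // mem_cat xw.
  have pz : {in z, forall x,
      coker_push T (qproj (range S) x) = (qproj (range (T \o S)) \o T) x}.
    by move=> x xz; rewrite coker_push_qproj.
  by rewrite EcTS (ext_map_mod_letters a4 pw pz) wedgeZr map_comp.
have [d5 a5] :
    exists d, alpha5 - d *: word (map (qproj (range (T \o S))) y)
      \in letter_ideal (map (qproj (range (T \o S))) (map T z)).
  have := cTS; rewrite /cokernel_basis map_cat => b; apply: (complement_right (c := d4) b h5).
    by rewrite -EcTS (val_generator_neq0 (line_det_word cTS) gcTS).
  by rewrite -EcTS -map_cat -(basis_dim cTS); apply: valP.
have {}EcTS : cokTS = (d4 * d5) *: det_cokernel (T \o S) (y ++ map T z).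
  by apply: (det_word_eq cTS); rewrite EcTS (mod_letters a5).2 -map_cat scalerA.
(* In coker T: T z vanishes modulo im T. *)
have {}EcT : cokT = d5 *: det_cokernel T y.
  have pz : {in map T z, forall x,
      coker_proj (S := S) (T := T) (qproj (range (T \o S)) x) = 0}.
    by move=> _ /mapP[x _ ->]; rewrite coker_proj_qproj; apply: qproj0; exists x.
  have py : {in y, forall x,
      coker_proj (S := S) (T := T) (qproj (range (T \o S)) x) = qproj (range T) x}.
    by move=> x xy; rewrite coker_proj_qproj.
  by apply: (det_word_eq cT); rewrite EcT (ext_map_mod_letters a5 pz py).
have d34 : d3 * d4 != 0.
  apply/eqP => d0; move: (val_generator_neq0 (line_det_word cS) gcS).
  by rewrite EcS d0 scale0r linear0 eqxx.
have d45 : d4 * d5 != 0.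
  apply/eqP => d0; move: (val_generator_neq0 (line_det_word cTS) gcTS).
  by rewrite EcTS d0 scale0r linear0 eqxx.
rewrite E1 EkTS EkT EcS EcTS EcT; apply: scale_generators FE => //; exact: line_det_word.
Qed.

(** A map with the prescribed value on the generator exists since its source
    is a line; it satisfies the specification, hence so does [phi], which may
    then be evaluated on the words in the given bases. *)
Lemma phi_on_bases :
  phi S T (tensor (detF_gen S u (w ++ z)) (detF_gen T (w ++ map S v) y)) =
    (-1) ^+ (size v * size z) *: detF_gen (T \o S) (u ++ v) (y ++ map T z).
Proof.
have lg := line_tensor (line_detF_gen kS cS) (line_detF_gen kT cT).
rewrite -rho_parity /phi; case: pselect => [ex|[]]; last first.
  have [F FE] := line_extend ((-1) ^+ rho S T *: detF_gen (T \o S) (u ++ v) (y ++ map T z)) lg.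
  by exists F; apply: phi_spec_on_bases.
case: (cid ex) => F Fspec /=.
have hw (X : lmodType K) (s : seq X) : homogeneous (word s).
  by exists (size s); apply: mem_extpow.
have gen (X : lmodType K) (s : seq X) : basis s -> generates (det_word s).
  by move/line_det_word/line_generates.
apply: (Fspec _ (word (map (to_kernel (T \o S)) v)) (word (map (to_kernel T) w))
          (word (map (qproj (range S)) z)) (word (map (qproj (range (T \o S))) y))).
- exact: hw.
- exact: hw.
- exact: hw.
- exact: hw.
- rewrite (val_det_kernel kTS) (val_det_kernel kS) ext_map_word (map_ker_incl kS.1).
  by rewrite wedge_word map_cat.
- rewrite (val_det_kernel kT) ext_map_word map_ker_push.
    by rewrite wedge_word map_cat.
  by move=> x xv; apply: kTS.1; rewrite mem_cat xv orbT.
- rewrite (val_det_cokernel cS) ext_map_word map_ker_coker.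
    by rewrite wedge_word map_cat.
  by move=> x xw; apply: kT.1; rewrite mem_cat xw.
- by rewrite (val_det_cokernel cTS) ext_map_word map_coker_push wedge_word map_cat.
- by rewrite (val_det_cokernel cT) ext_map_word map_coker_proj.
- exact: gen kS.2.
- exact: gen kTS.2.
- exact: gen kT.2.
- exact: gen cS.
- exact: gen cTS.
- exact: gen cT.
Qed.
End Phi.
End FredholmBases.

(** * Bases of subquotients *)

Section RelativeBases.
Context {K : fieldType}.
Implicit Types U V W : lmodType K.

Definition subspace V (P : set V) := P 0 /\ forall a x y, P x -> P y -> P (a *: x + y).

Lemma subspaceZ V (P : set V) a x : subspace P -> P x -> P (a *: x).
Proof. by case=> P0 PD Px; rewrite -[_ *: _]addr0; apply: PD. Qed.

Lemma subspaceD V (P : set V) x y : subspace P -> P x -> P y -> P (x + y).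
Proof. by case=> _ PD Px; rewrite -[x]scale1r; apply: PD. Qed.

Lemma subspaceB V (P : set V) x y : subspace P -> P x -> P y -> P (x - y).
Proof. by move=> sP Px Py; apply: subspaceD => //; rewrite -scaleN1r; apply: subspaceZ. Qed.

Lemma subspace0 V : subspace [set 0 : V].
Proof. by split=> // a x y /= -> ->; rewrite scaler0 addr0. Qed.

Lemma subspace_preimage V W (f : {linear V -> W}) (P : set W) :
  subspace P -> subspace (f @^-1` P).
Proof. by case=> P0 PD; split=> [|a x y Px Py]; rewrite /preimage /= ?linear0 ?linearP //; apply: PD. Qed.

Lemma subspace_range V W (f : {linear V -> W}) : subspace (range f).
Proof.
split; first by exists 0; rewrite ?linear0.
by move=> a _ _ [x _ <-] [y _ <-]; exists (a *: x + y); rewrite ?linearP.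
Qed.

Lemma subspace_ker V W (f : {linear V -> W}) : subspace [set x | f x = 0].
Proof. exact: (subspace_preimage f (subspace0 W)). Qed.

Lemma subspaceI V (P Q : set V) : subspace P -> subspace Q -> subspace (P `&` Q).
Proof. by move=> [P0 PD] [Q0 QD]; split=> // a x y [Px Qx] [Py Qy]; split; [apply: PD | apply: QD]. Qed.

Definition add_line V (P : set V) (x : V) : set V := [set y | exists a, P (y - a *: x)].

Lemma subspace_add_line V (P : set V) x : subspace P -> subspace (add_line P x).
Proof.
move=> sP; split; first by exists 0; rewrite scale0r subr0; case: sP.
move=> a y z [b Py] [c Pz]; exists (a * b + c).
rewrite scalerDl opprD addrACA -scalerA -scalerBr.
by case: sP => _; apply.
Qed.

Lemma add_line_sub V (P : set V) x y : P y -> add_line P x y.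
Proof. by move=> Py; exists 0; rewrite scale0r subr0. Qed.

Lemma add_line_in V (P Q : set V) x : subspace Q -> P `<=` Q -> Q x -> add_line P x `<=` Q.
Proof.
move=> sQ PQ Qx y [a /PQ Py]; rewrite -[y](subrK (a *: x)).
by apply: subspaceD => //; apply: subspaceZ.
Qed.

(** [s] is a basis of Q / P, described by the flag from P to Q that its
    elements span. In this form concatenation of bases along P <= Q <= R is
    immediate, and transport along a linear map is an induction without
    coefficients. *)
Fixpoint rel_basis V (P Q : set V) (s : seq V) : Prop :=
  if s is x :: s' then ~ P x /\ rel_basis (add_line P x) Q s' else P = Q.

Lemma rel_basis_cat V (P Q R : set V) s t :
  rel_basis P Q s -> rel_basis Q R t -> rel_basis P R (s ++ t).
Proof.
by elim: s P => [|x s IH] P /=; [move=> -> | case=> Px /IH Ps /Ps; split].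
Qed.

Lemma rel_basis_in V (P Q : set V) s : subspace P -> rel_basis P Q s ->
  P `<=` Q /\ {in s, forall x, Q x}.
Proof.
elim: s P => [|x s IH] P sP /=; first by move=> ->; split.
case=> _ /(IH _ (subspace_add_line x sP)) [PQ sQ]; split.
  by move=> y Py; apply/PQ/add_line_sub.
move=> y; rewrite inE => /predU1P[->|/sQ //]; apply: PQ; exists 1.
by rewrite scale1r subrr; case: sP.
Qed.

Definition add_lines V (P : set V) (s : seq V) := foldl (@add_line V) P s.

Lemma rel_basis_add_lines V (P Q : set V) s : rel_basis P Q s -> add_lines P s = Q.
Proof. by elim: s P => //= x s IH P [_ /IH]. Qed.

Lemma add_lines_mono V (P Q : set V) s : P `<=` Q -> add_lines P s `<=` add_lines Q s.
Proof.
elim: s P Q => //= x s IH P Q PQ; apply: IH => y [a Py]; exists a; exact: PQ.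
Qed.

Lemma subspace_add_lines V (P : set V) s : subspace P -> subspace (add_lines P s).
Proof. by elim: s P => //= x s IH P sP; apply/IH/subspace_add_line. Qed.

Lemma add_linesP V (P : set V) s y :
  add_lines P s y <-> exists c : nat -> K, P (y - \sum_(i < size s) c i *: s`_i).
Proof.
elim: s P => [|x s IH] P /=.
  split; first by move=> Py; exists (fun=> 0); rewrite big_ord0 subr0.
  by case=> c; rewrite big_ord0 subr0.
rewrite IH; split=> [[c [a Py]]|[c]].
  exists (fun i => if i is j.+1 then c j else a).
  by rewrite big_ord_recl /= opprD addrCA addrC addrAC addrC addrA [- _ + y]addrC.
rewrite big_ord_recl /= opprD addrA => Py.
by exists (fun i => c i.+1), (c 0%N); rewrite addrAC.
Qed.

(** A subspace of a finite dimensional quotient is finite dimensional. With G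
    the span of P and of all generators but the last one, either Q lies in G,
    or Q is spanned by its intersection with G and any one of its vectors
    outside of G. *)
Lemma exists_rel_basis V (P Q : set V) s : subspace P -> subspace Q ->
  P `<=` Q -> Q `<=` add_lines P s -> exists t, rel_basis P Q t.
Proof.
move=> sP; elim/last_ind: s Q => [|s x IH] Q sQ PQ QG.
  by exists [::]; apply/seteqP.
set G := add_lines P s in IH; have sG : subspace G by apply: subspace_add_lines.
have {}QG : Q `<=` add_line G x by move=> y /QG; rewrite /add_lines foldl_rcons.
have PG : P `<=` G.
  by move=> y Py; apply/add_linesP; exists (fun=> 0); rewrite big1 ?subr0 // => i _; rewrite scale0r.
have [||t Pt] := IH (Q `&` G) (subspaceI sQ sG).
- by move=> y Py; split; [apply: PQ | apply: PG].
- by move=> y [].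
have [QsubG|/existsNP[q /not_implyP[Qq Gq]]] := pselect (Q `<=` G).
  by exists t; rewrite -(setIidl QsubG).
exists (t ++ [:: q]); apply: rel_basis_cat Pt _; split; first by case.
apply/seteqP; split; first by apply: add_line_in => // y [].
move=> y Qy; have [a ya] := QG _ Qy; have [b qb] := QG _ Qq.
have b0 : b != 0 by apply/eqP => b0; apply: Gq; rewrite b0 scale0r subr0 in qb.
exists (a / b); split; first by apply: subspaceB => //; apply: subspaceZ.
have -> : y - (a / b) *: q = (y - a *: x) - (a / b) *: (q - b *: x).
  by rewrite scalerBr scalerA divfK // opprB addrA subrK.
by apply: subspaceB => //; apply: subspaceZ.
Qed.

(** [f] maps Q into Q' and induces an isomorphism from Q / P onto Q' / P'; the
    last two clauses are injectivity together with well-definedness, and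
    surjectivity. *)
Definition rel_iso V W (f : {linear V -> W}) (P Q : set V) (P' Q' : set W) :=
  [/\ subspace Q, P `<=` Q, subspace P',
      forall x, Q x -> (P' (f x) <-> P x) &
      forall y, Q' y <-> exists2 x, Q x & P' (y - f x)].

Lemma rel_iso_add_line V W (f : {linear V -> W}) P Q P' Q' x :
  rel_iso f P Q P' Q' -> Q x -> rel_iso f (add_line P x) Q (add_line P' (f x)) Q'.
Proof.
case=> sQ PQ sP' Pf Q'f Qx; split=> //; first exact: add_line_in.
- exact: subspace_add_line.
- move=> y Qy; have Qyx a : Q (y - a *: x).
    by apply: subspaceB => //; apply: subspaceZ.
  by split=> -[a Pa]; exists a; move: Pa; rewrite -linearZ -linearB Pf.
- move=> y; rewrite Q'f; split=> [[z Qz P'z]|[z Qz [a P'z]]].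
    by exists z => //; apply: add_line_sub.
  exists (z + a *: x); first by apply: subspaceD => //; apply: subspaceZ.
  by rewrite linearD linearZ opprD addrA.
Qed.

Lemma rel_basis_push V W (f : {linear V -> W}) P Q P' Q' s :
  rel_iso f P Q P' Q' -> rel_basis P Q s -> rel_basis P' Q' (map f s).
Proof.
elim: s P P' => [|x s IH] P P' iso /=; have [sQ PQ sP' Pf Q'f] := iso.
  move=> EPQ; apply/seteqP; split=> y.
    by move=> P'y; apply/Q'f; exists 0; [case: sQ | rewrite linear0 subr0].
  case/Q'f=> x Qx P'y; rewrite -[y](subrK (f x)); apply: subspaceD => //.
  by apply/(Pf _ Qx); rewrite EPQ.
case=> Px Ps; have P0 : P 0 by apply/Pf; rewrite ?linear0; [case: sQ | case: sP'].
(* The flag increases from [add_line P x], which contains [x], to [Q]. *)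
have Qx : Q x.
  have sub : forall P1 t, rel_basis P1 Q t -> P1 `<=` Q.
    move=> P1 t; elim: t P1 => [|u t IHt] P1 /=; first by move=> ->.
    by case=> _ /IHt sub y P1y; apply/sub/add_line_sub.
  by apply: (sub _ _ Ps); exists 1; rewrite scale1r subrr.
split; first by rewrite Pf.
by apply: IH Ps; apply: rel_iso_add_line.
Qed.

Lemma rel_basis_pull V W (f : {linear V -> W}) P Q P' Q' s :
  rel_iso f P Q P' Q' -> {in s, forall x, Q x} ->
  rel_basis P' Q' (map f s) -> rel_basis P Q s.
Proof.
elim: s P P' => [|x s IH] P P' iso /= sinQ; have [sQ PQ sP' Pf Q'f] := iso.
  move=> E; apply/seteqP; split=> // x Qx; apply/Pf => //; rewrite E.
  by apply/Q'f; exists x => //; rewrite subrr; case: sP'.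
have Qx : Q x by apply: sinQ; rewrite mem_head.
case=> P'x P's; split; first by rewrite -Pf.
apply: IH P's; first exact: rel_iso_add_line.
by move=> y ys; apply: sinQ; rewrite inE ys orbT.
Qed.

(** Finiteness of Q / P is obtained from that of the isomorphic Q' / P' by
    lifting a basis through [f]. *)
Lemma exists_rel_basis_pull V W (f : {linear V -> W}) P Q P' Q' t :
  rel_iso f P Q P' Q' -> (forall y, Q' y -> exists2 x, Q x & f x = y) ->
  rel_basis P' Q' t -> exists s, rel_basis P Q s.
Proof.
move=> iso lift P't; have [_ _ sP' _ _] := iso.
have [s sQ E] : exists2 s, {in s, forall x, Q x} & map f s = t.
  have [_] := rel_basis_in sP' P't; elim: t {P't} => [|y t IH] tQ; first by exists [::].
  have [s sQ <-] := IH (fun y yt => tQ y (mem_behead (s := _ :: _) yt)).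
  have [x Qx <-] := lift y (tQ y (mem_head _ _)).
  by exists (x :: s) => // z; rewrite inE => /predU1P[->|/sQ].
by exists s; apply: (rel_basis_pull iso sQ); rewrite E.
Qed.

Lemma rel_basis_free V (P Q : set V) s (c : nat -> K) : subspace P ->
  rel_basis P Q s -> P (\sum_(i < size s) c i *: s`_i) ->
  forall i, (i < size s)%N -> c i = 0.
Proof.
elim: s P c => [|x s IH] P c sP //= [Px Ps]; rewrite big_ord_recl /= => Pc.
have c0 i : (i < size s)%N -> c i.+1 = 0.
  apply: (IH _ (fun i => c i.+1) (subspace_add_line x sP) Ps).
  by exists (- c 0%N); rewrite scaleNr opprK addrC.
case=> [_|i]; last exact: c0.
apply: contra_notP Px => /eqP cx; rewrite -[x]scale1r -(mulVf cx) -scalerA.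
apply: subspaceZ => //; rewrite big1 ?addr0 // in Pc.
by move=> i _; rewrite c0 ?scale0r.
Qed.

(** Spanning and freeness make the map from coordinates to vectors bijective.
    *)
Lemma rel_basis_basis V (b : seq V) : rel_basis [set 0] setT b -> basis b.
Proof.
move=> bb; pose f (c : 'rV[K]_(size b)) := \sum_i c 0 i *: b`_i.
have fL : linear f.
  move=> a x y; rewrite /f scaler_sumr -big_split; apply: eq_bigr => i _.
  by rewrite !mxE scalerDl scalerA.
have span_f x : exists c, f c = x.
  have : add_lines [set 0] b x by rewrite (rel_basis_add_lines bb).
  case/add_linesP=> c /= /eqP; rewrite subr_eq0 => /eqP E.
  by exists (\row_i c i); rewrite E; apply: eq_bigr => i _; rewrite mxE.
have ker_f c : f c = 0 -> c = 0.
  move=> c0; apply/rowP => i; rewrite mxE.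
  pose c' j := if insub j is Some k then c 0 k else 0.
  have c'E (k : 'I_(size b)) : c' k = c 0 k by rewrite /c' valK.
  rewrite -c'E; apply: (rel_basis_free (c := c') (subspace0 V) bb) (ltn_ord i).
  by rewrite /= -[RHS]c0; apply: eq_bigr => k _; rewrite c'E.
have [g gK] := choice span_f.
have fK : cancel f g.
  move=> c; apply/eqP; rewrite -subr_eq0; apply/eqP/ker_f.
  by rewrite -[LHS]/(linear_of fL _) linearB /= gK subrr.
split; last first.
  move=> x; rewrite -(gK x) /f; apply: rpred_sum => i _; apply: rpredZ.
  by apply: mem_span; apply: mem_nth.
split; exists g; last by exists f.
exact: (can2_linear (f := linear_of fL)).
Qed.

Lemma finite_dim_rel_basis V : finite_dim V -> exists s, rel_basis [set 0 : V] setT s.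
Proof.
case=> n [[g gL [f gK fK]]].
apply: (@exists_rel_basis _ _ _ [seq f (delta_mx 0 i) | i <- enum 'I_n]) => //.
  exact: subspace0.
move=> x _; apply/add_linesP; rewrite size_map size_enum_ord.
exists (fun j => if insub j is Some k then g x 0 k else 0) => /=.
apply/eqP; rewrite subr_eq0; apply/eqP.
have fL : linear f by exact: (can2_linear (f := linear_of gL)).
rewrite -[LHS]gK [g x in LHS]row_sum_delta -[LHS]/(linear_of fL _) linear_sum /=.
apply: eq_bigr => i _; rewrite (linear_funZ _ _ fL) valK.
by rewrite (nth_map i) ?size_enum_ord // nth_ord_enum.
Qed.

End RelativeBases.

(** * Bases of kernels and cokernels as relative bases *)

Section KernelCokernelBases.
Context {K : fieldType}.
Context {U V : lmodType K} (f : {linear U -> V}).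

Lemma rel_iso_val :
  rel_iso (\val : {linear kernel f -> U}) [set 0] setT [set 0] [set x | f x = 0].
Proof.
split=> //; first exact: subspace0.
  have v0 : \val (0 : kernel f) = 0 by rewrite linear0.
  move=> x _; split=> [x0|->]; last exact: v0.
  by apply: val_inj; apply: etrans x0 (esym v0).
move=> x /=; split=> [fx|[y _ /eqP]]; last first.
  by rewrite subr_eq0 => /eqP->; apply/mem_kernel/(valP y).
by exists (to_kernel f x) => //; rewrite val_to_kernel // subrr.
Qed.

Lemma rel_iso_qproj :
  rel_iso (qproj (range f) : {linear V -> cokernel f}) (range f) setT [set 0] setT.
Proof.
split=> //; first exact: subspace0.
  move=> y _ /=; rewrite -(linear0 (qproj (range f))) qproj_eq subr0 mem_range.
  by split=> [[x <-]|[x _ <-]]; exists x.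
by move=> q; split=> // _; have [x <-] := qproj_surj q; exists x => //=; rewrite subrr.
Qed.

Lemma kernel_basis_rel s : rel_basis [set 0] [set x | f x = 0] s -> kernel_basis f s.
Proof.
move=> bs; have [_ s0] := rel_basis_in (subspace0 U) bs; split=> //.
apply: rel_basis_basis; apply: (rel_basis_pull rel_iso_val) => //.
rewrite -map_comp (_ : map _ s = s) // -[RHS]map_id.
by apply/eq_in_map => x /s0 fx; rewrite /= val_to_kernel.
Qed.

Lemma cokernel_basis_rel t : rel_basis (range f) setT t -> cokernel_basis f t.
Proof. by move/(rel_basis_push rel_iso_qproj)/rel_basis_basis. Qed.

Lemma finite_kernel : finite_dim (kernel f) ->
  exists s, rel_basis [set 0] [set x | f x = 0] s.
Proof.
by case/finite_dim_rel_basis=> s /(rel_basis_push rel_iso_val); eexists; eassumption.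
Qed.

Lemma finite_cokernel : finite_dim (cokernel f) ->
  exists t, rel_basis (range f) setT t.
Proof.
case/finite_dim_rel_basis=> s; apply: (exists_rel_basis_pull rel_iso_qproj) => q _.
by have [x <-] := qproj_surj q; exists x.
Qed.
End KernelCokernelBases.

(** * Bases adapted to three composable maps *)

Section Triple.
Context {K : fieldType} {U1 U2 U3 U4 : lmodType K}.
Variables (A : {linear U1 -> U2}) (B : {linear U2 -> U3}) (C : {linear U3 -> U4}).

Let kA := [set x | A x = 0].
Let kBA := [set x | B (A x) = 0].
Let kCBA := [set x | C (B (A x)) = 0].
Let kB := [set x | B x = 0].
Let kCB := [set x | C (B x) = 0].
Let kC := [set x | C x = 0].
Let rA := range A.
Let rBA := range (B \o A).
Let rCBA := range (C \o (B \o A)).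
Let rB := range B.
Let rCB := range (C \o B).
Let rC := range C.

(** This and the following lemmas, up to [iso_top_cCB], are the isomorphisms
    of subquotients along which the families xij of the introduction are
    transported. *)
Lemma iso_kBA : rel_iso A kA kBA [set 0] (rA `&` kB).
Proof.
split=> //; first exact: (subspace_ker (B \o A)).
- by move=> x Ax; rewrite /kBA /= Ax linear0.
- exact: subspace0.
- move=> y; split=> [[[x _ <-] By]|[x BAx /eqP]]; first by exists x; rewrite //= subrr.
  by rewrite subr_eq0 => /eqP->; split=> //; exists x.
Qed.

Lemma iso_kCBA : rel_iso A kBA kCBA (rA `&` kB) (rA `&` kCB).
Proof.
split; first exact: (subspace_ker (C \o (B \o A))).
- by move=> x BAx; rewrite /kCBA /= BAx linear0.
- exact: subspaceI (subspace_range A) (subspace_ker B).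
- by move=> x _; split=> [[]//|BAx]; split=> //; exists x.
- move=> y; split=> [[[x _ <-] By]|[x CBAx [[x' _ E] Bx']]].
    by exists x => //; rewrite subrr; case: (subspaceI (subspace_range A) (subspace_ker B)).
  rewrite -[y](subrK (A x)); split; last by rewrite /kCB /= linearD Bx' add0r.
  by exists (x' + x); rewrite // linearD E.
Qed.

Lemma iso_kCBA_kC : rel_iso (B \o A) kBA kCBA [set 0] (rBA `&` kC).
Proof.
split=> //; first exact: (subspace_ker (C \o (B \o A))).
- by move=> x BAx; rewrite /kCBA /= BAx linear0.
- exact: subspace0.
- move=> y; split=> [[[x _ <-] Cy]|[x BAx /eqP]]; first by exists x; rewrite //= subrr.
  by rewrite subr_eq0 => /eqP->; split=> //; exists x.
Qed.

(* Sums of a kernel and an image, written as preimages: im A + ker B,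
   im A + ker CB, ker B + (im A /\ ker CB), im B + ker C and
   im BA + (im B /\ ker C). *)
Let rA_kB := B @^-1` rBA.
Let rA_kCB := (C \o B) @^-1` rCBA.
Let rAkCB_kB := kCB `&` rA_kB.
Let rB_kC := C @^-1` rCB.
Let rBA_rBkC := rB `&` C @^-1` rCBA.

Lemma iso_kB_kCB : rel_iso (idfun : {linear U2 -> U2}) (rA `&` kB) kB (rA `&` kCB) rAkCB_kB.
Proof.
split.
- exact: subspace_ker.
- by move=> y [].
- exact: subspaceI (subspace_range A) (subspace_ker (C \o B)).
- by move=> y By; split=> -[ry _]; split=> //; rewrite /kCB /= By linear0.
- move=> y; split=> [[CBy [x _ BAx]]|[z Bz [[x _ /= E] CBy]]].
    exists (y - A x); first by rewrite /kB /= linearB -BAx subrr.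
    by rewrite /= subKr; split; [exists x | rewrite /kCB /= -[B (A x)]/((B \o A) x) BAx].
  split; first by move: CBy; rewrite /kCB /= !linearB Bz linear0 subr0.
  by exists x => //=; rewrite E linearB Bz subr0.
Qed.

Lemma iso_kB_cA : rel_iso (idfun : {linear U2 -> U2}) (rA `&` kB) kB rA rA_kB.
Proof.
split.
- exact: subspace_ker.
- by move=> y [].
- exact: subspace_range.
- by move=> y By; split=> [|[]].
- move=> y; split=> [[x _ BAx]|[z Bz [x _ /= E]]].
    exists (y - A x); first by rewrite /kB /= linearB -BAx subrr.
    by rewrite /= subKr; exists x.
  by exists x => //=; rewrite E linearB Bz subr0.
Qed.

Lemma iso_kCB_cA : rel_iso (idfun : {linear U2 -> U2}) rAkCB_kB kCB rA_kB rA_kCB.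
Proof.
have srBA := subspace_range (B \o A).
split.
- exact: (subspace_ker (C \o B)).
- by move=> y [].
- exact: subspace_preimage.
- by move=> y CBy; split=> [|[]].
- move=> y; split=> [[x _ E]|[z CBz [x _ /= E]]].
    exists (y - A x); first by rewrite /kCB /= !linearB -[C (B y)]E subrr.
    by rewrite /= subKr; exists x.
  by exists x => //=; rewrite E !linearB CBz subr0.
Qed.

Lemma iso_kCB_kC : rel_iso B rAkCB_kB kCB (rBA `&` kC) (rB `&` kC).
Proof.
split.
- exact: (subspace_ker (C \o B)).
- by move=> y [].
- exact: subspaceI (subspace_range _) (subspace_ker C).
- by move=> y CBy; split=> -[? ?]; split.
- move=> z; split=> [[[y _ <-] CBy]|[y CBy [[x _ E] Cz]]].
    exists y => //; rewrite subrr.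
    by case: (subspaceI (subspace_range (B \o A)) (subspace_ker C)).
  rewrite -[z](subrK (B y)) -E; split; first by exists (A x + y); rewrite // linearD.
  by rewrite E /kC /= linearD Cz add0r.
Qed.

Lemma iso_kCB_cBA : rel_iso B rAkCB_kB kCB rBA rBA_rBkC.
Proof.
split.
- exact: (subspace_ker (C \o B)).
- by move=> y [].
- exact: subspace_range.
- by move=> y CBy; split=> [|[]].
- move=> z; split=> [[[y _ <-] [x _ E]]|[y CBy [x _ E]]].
    exists (y - A x); first by rewrite /kCB /= !linearB -E subrr.
    by rewrite linearB subKr; exists x.
  rewrite -[z](subrK (B y)) -E; split; first by exists (A x + y); rewrite // linearD.
  by exists x => //; rewrite linearD CBy addr0.
Qed.

Lemma iso_top_cBA : rel_iso B rA_kCB setT rBA_rBkC rB.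
Proof.
split=> //.
- exact: subspaceI (subspace_range B) (subspace_preimage C (subspace_range _)).
- by move=> y _; split=> [[]|ry] //; split=> //; exists y.
- move=> z; split=> [[y _ <-]|[y _ [[y' _ E] _]]].
    exists y => //; rewrite subrr; apply: (subspaceI _ _).1; first exact: subspace_range.
    exact: subspace_preimage (subspace_range _).
  by rewrite -[z](subrK (B y)) -E; exists (y' + y); rewrite // linearD.
Qed.

Lemma iso_top_cCBA : rel_iso (C \o B) rA_kCB setT rCBA rCB.
Proof.
split=> //.
- exact: subspace_range.
- move=> z; split=> [[y _ <-]|[y _ [x _ E]]].
    by exists y => //; rewrite subrr; case: (subspace_range (C \o (B \o A))).
  by rewrite -[z](subrK ((C \o B) y)) -E; exists (A x + y); rewrite // linearD.
Qed.

Lemma iso_kC_cB : rel_iso (idfun : {linear U3 -> U3}) (rB `&` kC) kC rB rB_kC.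
Proof.
split.
- exact: subspace_ker.
- by move=> y [].
- exact: subspace_range.
- by move=> y By; split=> [|[]].
- move=> y; split=> [[x _ E]|[z Cz [x _ /= E]]].
    exists (y - B x); first by rewrite /kC /= linearB -E subrr.
    by rewrite /= subKr; exists x.
  by exists x => //=; rewrite E linearB Cz subr0.
Qed.

Lemma iso_top_cCB : rel_iso C rB_kC setT rCB rC.
Proof.
split=> //.
- exact: subspace_range.
- move=> z; split=> [[y _ <-]|[y _ [x _ E]]].
    by exists y => //; rewrite subrr; case: (subspace_range (C \o B)).
  by rewrite -[z](subrK (C y)) -E; exists (B x + y); rewrite // linearD.
Qed.

(** Each family is a basis of one subquotient: x11, x12, x13 of the steps of
    ker A <= ker BA <= ker CBA; x22 of ker B modulo im A, x23 of ker CB modulo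
    ker B and im A, x24 of U2 modulo ker CB and im A; x33 of ker C modulo im
    B, x34 of U3 modulo ker C and im B; x44 of coker C. Pushed forward they
    form the steps of filtrations of all six kernels and all six cokernels. *)
Lemma adapted_bases :
  finite_dim (kernel A) -> finite_dim (cokernel A) ->
  finite_dim (kernel B) -> finite_dim (cokernel B) ->
  finite_dim (kernel C) -> finite_dim (cokernel C) ->
  exists x11 x12 x13 x22 x23 x24 x33 x34 x44,
  [/\ kernel_basis A x11, kernel_basis (B \o A) (x11 ++ x12),
      kernel_basis (C \o (B \o A)) (x11 ++ x12 ++ x13) &
  [/\ kernel_basis B (map A x12 ++ x22),
      kernel_basis (C \o B) (map A x12 ++ map A x13 ++ x22 ++ x23),
      kernel_basis C (map B (map A x13) ++ map B x23 ++ x33) &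
  [/\ cokernel_basis A (x22 ++ x23 ++ x24), cokernel_basis B (x33 ++ x34), cokernel_basis C x44 &
  [/\ cokernel_basis (B \o A) (map B x23 ++ map B x24 ++ x33 ++ x34),
      cokernel_basis (C \o B) (map C x34 ++ x44) &
      cokernel_basis (C \o (B \o A)) (map C (map B x24) ++ map C x34 ++ x44)]]]].
Proof.
move=> /finite_kernel[x11 bkA] /finite_cokernel[cA bcA].
move=> /finite_kernel[sB bkB] /finite_cokernel[cB bcB].
move=> /finite_kernel[sC bkC] /finite_cokernel[x44 bcC].
have [lkB lkC] := (rel_basis_add_lines bkB, rel_basis_add_lines bkC).
have [lcA lcB] := (rel_basis_add_lines bcA, rel_basis_add_lines bcB).
have sub0 (X : lmodType K) (P : set X) : subspace P -> [set 0] `<=` P.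
  by case=> P0 _ x ->.
have top (X : lmodType K) (P Q R : set X) s : subspace P -> subspace Q ->
    add_lines P s = R -> P `<=` Q -> Q `<=` R -> exists t, rel_basis Q R t.
  move=> sP sQ <- PQ QR; apply: (@exists_rel_basis _ _ _ _ s) => //.
    exact: subspace_add_lines.
  exact: add_lines_mono.
have bot (X : lmodType K) (P Q R : set X) s : subspace P -> subspace Q ->
    add_lines P s = R -> P `<=` Q -> Q `<=` R -> exists t, rel_basis P Q t.
  by move=> sP sQ <- PQ QR; apply: (@exists_rel_basis _ _ _ _ s).
have skB := subspace_ker B; have skC := subspace_ker C.
have srA := subspace_range A; have srB := subspace_range B.
(* x12, x13 and x23 are lifted from U2 and U3, where finiteness is known; the
   other families are chosen in place. *)
have [t12 b12'] : exists t, rel_basis [set 0] (rA `&` kB) t.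
  apply: (bot _ _ _ _ _ (subspace0 _) (subspaceI srA skB) lkB); last by move=> y [].
  exact: sub0 (subspaceI srA skB).
have [x12 b12] : exists s, rel_basis kA kBA s.
  by apply: exists_rel_basis_pull iso_kBA _ b12' => y [[x _ <-] By]; exists x.
have srBAkC := subspaceI (subspace_range (B \o A)) skC.
have [t13 b13'] : exists t, rel_basis [set 0] (rBA `&` kC) t.
  apply: (bot _ _ _ _ _ (subspace0 _) srBAkC lkC); last by move=> y [].
  exact: sub0 srBAkC.
have [x13 b13] : exists s, rel_basis kBA kCBA s.
  by apply: exists_rel_basis_pull iso_kCBA_kC _ b13' => y [[x _ <-] By]; exists x.
have [x22 b22] : exists s, rel_basis (rA `&` kB) kB s.
  apply: (top _ _ _ _ _ (subspace0 _) (subspaceI srA skB) lkB); last by move=> y [].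
  exact: sub0 (subspaceI srA skB).
have srBkC := subspaceI srB skC.
have [x33 b33] : exists s, rel_basis (rB `&` kC) kC s.
  apply: (top _ _ _ _ _ (subspace0 _) srBkC lkC); last by move=> y [].
  exact: sub0 srBkC.
have [t23 b23'] : exists t, rel_basis (rBA `&` kC) (rB `&` kC) t.
  have [t bt] : exists t, rel_basis [set 0] (rB `&` kC) t.
    apply: (bot _ _ _ _ _ (subspace0 _) srBkC lkC); last by move=> y [].
    exact: sub0 srBkC.
  apply: (top _ _ _ _ _ (subspace0 _) srBAkC (rel_basis_add_lines bt)); first exact: sub0 srBAkC.
  by move=> _ [[x _ <-] Cx]; split=> //; exists (A x).
have [x23 b23] : exists s, rel_basis rAkCB_kB kCB s.
  by apply: exists_rel_basis_pull iso_kCB_kC _ b23' => y [[x _ <-] By]; exists x.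
have [x24 b24] : exists s, rel_basis rA_kCB setT s.
  have srAkCB := subspace_preimage (C \o B) (subspace_range (C \o (B \o A))).
  apply: (top _ _ _ _ _ srA srAkCB lcA) => //.
  by move=> _ [x _ <-]; exists x.
have [x34 b34] : exists s, rel_basis rB_kC setT s.
  have srBkC' := subspace_preimage C (subspace_range (C \o B)).
  apply: (top _ _ _ _ _ srB srBkC' lcB) => //.
  by move=> _ [x _ <-]; exists x.
have p12 := rel_basis_push iso_kBA b12.
have p13 := rel_basis_push iso_kCBA b13.
have p13' : rel_basis [set 0] (rBA `&` kC) (map B (map A x13)).
  by rewrite -map_comp; apply: rel_basis_push iso_kCBA_kC b13.
have p22 := rel_basis_push iso_kB_kCB b22.
have p22' := rel_basis_push iso_kB_cA b22.
have p23 := rel_basis_push iso_kCB_cA b23.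
have p23' := rel_basis_push iso_kCB_kC b23.
have p23'' := rel_basis_push iso_kCB_cBA b23.
have p24 := rel_basis_push iso_top_cBA b24.
have p24' : rel_basis rCBA rCB (map C (map B x24)).
  by rewrite -map_comp; apply: rel_basis_push iso_top_cCBA b24.
have p33 := rel_basis_push iso_kC_cB b33.
have p34 := rel_basis_push iso_top_cCB b34.
rewrite !map_id in p22 p22' p23 p33.
exists x11, x12, x13, x22, x23, x24, x33, x34, x44.
split; [| | |split; [| | |split; [| | |split]]].
- exact: kernel_basis_rel.
- by apply: kernel_basis_rel; apply: rel_basis_cat bkA b12.
- apply: kernel_basis_rel; exact: rel_basis_cat bkA (rel_basis_cat b12 b13).
- by apply: kernel_basis_rel; apply: rel_basis_cat p12 b22.
- apply: kernel_basis_rel; exact: rel_basis_cat p12 (rel_basis_cat p13 (rel_basis_cat p22 b23)).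
- by apply: kernel_basis_rel; apply: rel_basis_cat p13' (rel_basis_cat p23' b33).
- by apply: cokernel_basis_rel; apply: rel_basis_cat p22' (rel_basis_cat p23 b24).
- by apply: cokernel_basis_rel; apply: rel_basis_cat p33 b34.
- exact: cokernel_basis_rel.
- apply: cokernel_basis_rel; exact: rel_basis_cat p23'' (rel_basis_cat p24 (rel_basis_cat p33 b34)).
- by apply: cokernel_basis_rel; apply: rel_basis_cat p34 bcC.
- apply: cokernel_basis_rel; exact: rel_basis_cat p24' (rel_basis_cat p34 bcC).
Qed.

End Triple.

(** * Signs of block interchanges *)

Section BlockSigns.
Context {K : fieldType}.

Lemma det_word_blocks (V : lmodType K) (s t p q : seq V) : basis (s ++ t ++ p ++ q) ->
  det_word (s ++ t ++ p ++ q) = (-1) ^+ (size t * size p) *: det_word (s ++ p ++ t ++ q).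
Proof.
move=> b; apply: det_word_eq; last by rewrite val_det_word ?(basis_dim b) // word_blocks.
by apply: basis_perm b; rewrite perm_cat2l perm_catCA.
Qed.

Lemma tensor_dual_sign (L M : lmodType K) (x : M) (xi eta : L) n :
  line eta -> xi = (-1) ^+ n *: eta ->
  tensor x (dual_gen xi) = (-1) ^+ n *: tensor x (dual_gen eta).
Proof.
move=> leta ->; rewrite (dual_genZ leta) ?signr_eq0 // invr_sign.
exact: (tensorZr _ x).
Qed.

Lemma detF_gen_kernel_blocks (U V : lmodType K) (f : U -> V) (s t p q : seq U) (r : seq V) :
  kernel_basis f (s ++ t ++ p ++ q) ->
  detF_gen f (s ++ t ++ p ++ q) r = (-1) ^+ (size t * size p) *: detF_gen f (s ++ p ++ t ++ q) r.
Proof.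
case=> _ b; have E : det_kernel f (s ++ t ++ p ++ q) =
    (-1) ^+ (size t * size p) *: det_kernel f (s ++ p ++ t ++ q).
  rewrite !map_cat in b; rewrite /det_kernel !map_cat.
  by rewrite -(size_map (to_kernel f) t) -(size_map (to_kernel f) p); apply: det_word_blocks.
by rewrite /detF_gen E; apply: (tensorZl _ (det_kernel f _)).
Qed.

Lemma detF_gen_cokernel_blocks (U V : lmodType K) (f : U -> V) (r : seq U) (s t p q : seq V) :
  cokernel_basis f (s ++ t ++ p ++ q) ->
  detF_gen f r (s ++ t ++ p ++ q) = (-1) ^+ (size t * size p) *: detF_gen f r (s ++ p ++ t ++ q).
Proof.
move=> b; have b' : cokernel_basis f (s ++ p ++ t ++ q).
  by apply: cokernel_basis_perm b; rewrite perm_cat2l perm_catCA.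
have E : det_cokernel f (s ++ t ++ p ++ q) =
    (-1) ^+ (size t * size p) *: det_cokernel f (s ++ p ++ t ++ q).
  move: b; rewrite /cokernel_basis /det_cokernel !map_cat.
  by rewrite -(size_map (qproj (range f)) t) -(size_map (qproj (range f)) p); apply: det_word_blocks.
exact: tensor_dual_sign (line_det_word b') E.
Qed.
End BlockSigns.

(** * Comparison of the two bracketings *)

Section Associativity.
Context {K : fieldType} {U1 U2 U3 U4 : lmodType K}.
Variables (A : {linear U1 -> U2}) (B : {linear U2 -> U3}) (C : {linear U3 -> U4}).
Variables (x11 x12 x13 : seq U1) (x22 x23 x24 : seq U2) (x33 x34 : seq U3) (x44 : seq U4).
Hypotheses
  (kA : kernel_basis A x11) (kBA : kernel_basis (B \o A) (x11 ++ x12))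
  (kCBA : kernel_basis (C \o (B \o A)) (x11 ++ x12 ++ x13))
  (kB : kernel_basis B (map A x12 ++ x22))
  (kCB : kernel_basis (C \o B) (map A x12 ++ map A x13 ++ x22 ++ x23))
  (kC : kernel_basis C (map B (map A x13) ++ map B x23 ++ x33))
  (cA : cokernel_basis A (x22 ++ x23 ++ x24)) (cB : cokernel_basis B (x33 ++ x34)) (cC : cokernel_basis C x44)
  (cBA : cokernel_basis (B \o A) (map B x23 ++ map B x24 ++ x33 ++ x34))
  (cCB : cokernel_basis (C \o B) (map C x34 ++ x44))
  (cCBA : cokernel_basis (C \o (B \o A)) (map C (map B x24) ++ map C x34 ++ x44)).

Let gA := detF_gen A x11 (x22 ++ x23 ++ x24).
Let gB := detF_gen B (x22 ++ map A x12) (x33 ++ x34).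
Let gC := detF_gen C (x33 ++ map B x23 ++ map B (map A x13)) x44.
Let gBA := detF_gen (B \o A) (x11 ++ x12) (x33 ++ map B x23 ++ x34 ++ map B x24).
Let gCB := detF_gen (C \o B) (x22 ++ x23 ++ map A x12 ++ map A x13) (x44 ++ map C x34).
Let gCBA := detF_gen (C \o (B \o A)) (x11 ++ x12 ++ x13) (x44 ++ map C x34 ++ map C (map B x24)).

Let kB' : kernel_basis B (x22 ++ map A x12).
Proof. by apply: kernel_basis_perm kB; rewrite perm_catC. Qed.

Let kC' : kernel_basis C (x33 ++ map B x23 ++ map B (map A x13)).
Proof. by apply: kernel_basis_perm kC; rewrite perm_catC -catA perm_catCA. Qed.

Let kCB' : kernel_basis (C \o B) (x22 ++ map A x12 ++ x23 ++ map A x13).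
Proof.
apply: kernel_basis_perm kCB; rewrite perm_sym perm_catCA perm_cat2l.
by rewrite catA perm_catC catA.
Qed.

Let kCB'' : kernel_basis (C \o B) (x22 ++ x23 ++ map A x12 ++ map A x13).
Proof. by apply: kernel_basis_perm kCB'; rewrite perm_cat2l perm_catCA. Qed.

Let cBA' : cokernel_basis (B \o A) (x33 ++ x34 ++ map B x23 ++ map B x24).
Proof. by apply: cokernel_basis_perm cBA; rewrite catA perm_catC -catA. Qed.

Let cBA'' : cokernel_basis (B \o A) (x33 ++ map B x23 ++ x34 ++ map B x24).
Proof. by apply: cokernel_basis_perm cBA'; rewrite perm_cat2l perm_catCA. Qed.

Let cCB' : cokernel_basis (C \o B) (x44 ++ map C x34).
Proof. by apply: cokernel_basis_perm cCB; rewrite perm_catC. Qed.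

Let cCBA' : cokernel_basis (C \o (B \o A)) (x44 ++ map C x34 ++ map C (map B x24)).
Proof. by apply: cokernel_basis_perm cCBA; rewrite perm_catC -catA perm_catCA. Qed.

(** The exponent has one contribution from [phi_on_bases] and one from
    reordering 22 12 23 13 as 22 23 12 13, the form required by the next
    application of phi. *)
Lemma phi_B_C : phi B C (tensor gB gC) =
  (-1) ^+ ((size x23 + size x13) * size x34 + size x12 * size x23) *: gCB.
Proof.
have := @phi_on_bases K U2 U3 U4 B C (x22 ++ map A x12) (x23 ++ map A x13) x33 x34 x44.
rewrite !map_cat -!catA size_cat size_map => E.
by rewrite E // (detF_gen_kernel_blocks _ kCB') size_map scalerA -exprD.
Qed.

(** The type ascription compares two convertible descriptions of the same
    determinant line, attached to the two bracketings of CBA. *)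
Lemma phi_A_CB : phi A (C \o B) (tensor gA gCB) =
  (-1) ^+ ((size x12 + size x13) * size x24) *: (gCBA : DetF ((C \o B) \o A)).
Proof.
have := @phi_on_bases K U1 U2 U4 A (C \o B) x11 (x12 ++ x13) (x22 ++ x23) x24 (x44 ++ map C x34).
have E s : map (C \o B) s = map C (map B s) by rewrite -map_comp.
rewrite E !map_cat -!catA size_cat => F.
by apply: F.
Qed.

(** Here 33 34 23 24 is reordered as 33 23 34 24. *)
Lemma phi_A_B : phi A B (tensor gA gB) =
  (-1) ^+ (size x12 * (size x23 + size x24) + size x34 * size x23) *: gBA.
Proof.
have := @phi_on_bases K U1 U2 U3 A B x11 x12 x22 (x23 ++ x24) (x33 ++ x34).
rewrite !map_cat -!catA size_cat => E.
by rewrite E // (detF_gen_cokernel_blocks _ cBA') size_map scalerA -exprD.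
Qed.

Lemma phi_BA_C : phi (B \o A) C (tensor gBA gC) =
  (-1) ^+ (size x13 * (size x34 + size x24)) *: gCBA.
Proof.
have := @phi_on_bases K U1 U3 U4 (B \o A) C (x11 ++ x12) x13 (x33 ++ map B x23)
  (x34 ++ map B x24) x44.
have E s : map (B \o A) s = map B (map A s) by rewrite -map_comp.
rewrite E !map_cat -!catA size_cat size_map => F.
by apply: F.
Qed.

Lemma phi_assoc_generator :
  phi A (C \o B) (tens_map idfun (phi B C) (tens_assoc (tensor (tensor gA gB) gC))) =
  phi (B \o A) C (tens_map (phi A B) idfun (tensor (tensor gA gB) gC)).
Proof.
rewrite tens_assocE !tens_mapE /= phi_B_C phi_A_B.
rewrite (tensorZr _ gA) (tensorZl _ _ gC) [LHS]linearZ [RHS]linearZ /=.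
rewrite phi_A_CB phi_BA_C !scalerA -!exprD.
congr (_ *: _); rewrite -signr_odd -[RHS]signr_odd; congr (_ ^+ _).
rewrite !oddD !oddM !oddD.
by do 5!case: (odd (size _)).
Qed.

Lemma line_triple : line (tensor (tensor gA gB) gC).
Proof. by apply: line_tensor; [apply: line_tensor|]; apply: line_detF_gen. Qed.
End Associativity.

Lemma phi_assoc (K : fieldType) (U1 U2 U3 U4 : lmodType K)
    (A : {linear U1 -> U2}) (B : {linear U2 -> U3}) (C : {linear U3 -> U4}) :
  finite_dim (kernel A) -> finite_dim (cokernel A) ->
  finite_dim (kernel B) -> finite_dim (cokernel B) ->
  finite_dim (kernel C) -> finite_dim (cokernel C) ->
  phi A (C \o B) \o tens_map idfun (phi B C) \o tens_assoc
  = phi (B \o A) C \o tens_map (phi A B) idfun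
  :> (tens (tens (DetF A) (DetF B)) (DetF C) -> DetF (C \o B \o A)).
Proof.
move=> kA cA kB cB kC cC.
have [x11 [x12 [x13 [x22 [x23 [x24 [x33 [x34 [x44]]]]]]]]] := adapted_bases kA cA kB cB kC cC.
case=> bkA bkBA bkCBA [bkB bkCB bkC [bcA bcB bcC [bcBA bcCB bcCBA]]].
have lg := line_triple bkA bkB bkC bcA bcB bcC.
have [f _ fE] := lg.
have gen := phi_assoc_generator bkA bkBA bkCBA bkB bkCB bkC bcA bcB bcC bcBA bcCB bcCBA.
apply: funext => t; rewrite (fE t).
set g := tensor (tensor _ _) _ in gen *; set c := f t.
(* The two sides take values in convertible lines which carry structures
   presented by different bracketings, so each of them is reduced to the
   generator on its own. *)
have L := linearZ_LR (phi A (C \o B) \o tens_map idfun (phi B C) \o tens_assoc) c g.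
have R := linearZ_LR (phi (B \o A) C \o tens_map (phi A B) idfun) c g.
refine (etrans L _).
refine (etrans _ (esym R)).
by congr (_ *: _); exact gen.
Qed.

Theorem mainTheorem8 (R : realType) (k : scalar_kind)
    (H1 H2 H3 H4 : hilbertType R k)
    (T1 : {linear H1 -> H2}) (T2 : {linear H2 -> H3}) (T3 : {linear H3 -> H4}) :
  fredholm T1 -> fredholm T2 -> fredholm T3 ->
  phi T1 (T3 \o T2) \o tens_map idfun (phi T2 T3) \o tens_assoc
  = phi (T2 \o T1) T3 \o tens_map (phi T1 T2) idfun
  :> (tens (tens (DetF T1) (DetF T2)) (DetF T3) -> DetF (T3 \o T2 \o T1)).
Proof.
move=> [_ k1 c1] [_ k2 c2] [_ k3 c3].
exact: phi_assoc k1 c1 k2 c2 k3 c3.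
Qed.
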